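(* Suppose a function $\phi$ is analytic and univalent in the unit disk $\mathbb{D}$, and its range $\phi(\mathbb{D})$ is convex in the horizontal direction. Let $f=h+\overline g$ be the harmonic shear of $\phi$ in the horizontal direction with dilatation $q^2$, where $q$ is analytic and $|q(z)|<1$ in $\mathbb{D}$. Then $\|\mathcal{S}f\|<\infty$.
   Context: $\mathbb{D}=\{z\in\mathbb{C}:|z|<1\}$. A domain is convex in the horizontal direction if its intersection with every horizontal line is connected (or empty). The harmonic shear of $\phi$ in the horizontal direction with dilatation $q^2$ is the harmonic mapping $f=h+\overline g$, where $h,g$ are analytic functions in $\mathbb{D}$ determined (up to additive constants) by $h-g=\phi$ and $g'/h'=q^2$; thus $h'=\phi'/(1-q^2)$ and $g'=q^2\phi'/(1-q^2)$. The Schwarzian derivative of the harmonic mapping $f=h+\overline g$ is $\mathcal{S}f=2(\sigma_{zz}-\sigma_z^2)$, where $\sigma=\log(|h'|+|g'|)$ and $\sigma_z=\frac12\left(\frac{\partial\sigma}{\partial x}-i\frac{\partial\sigma}{\partial y}\right)$, $z=x+iy$. The Schwarzian norm is $\|\mathcal{S}f\|=\sup_{z\in\mathbb{D}}(1-|z|^2)^2|\mathcal{S}f(z)|$. *)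

(* Defs.v *)
(* Stdlib reals with Coquelicot; [C] is Coquelicot's type of complex numbers. *)
From Stdlib Require Export Reals.
From Coquelicot Require Export Coquelicot.
Open Scope R_scope.

Definition disk (z : C) : Prop := Cmod z < 1.

(* Complex differentiability; under it [C_derive f] is the derivative of [f]
   ([C_derive_correct]). *)
Definition analytic_in_disk (f : C -> C) : Prop :=
  forall z : C, disk z -> ex_derive (K := C_AbsRing) (V := C_NormedModule) f z.

Definition univalent_in_disk (f : C -> C) : Prop :=
  forall z w : C, disk z -> disk w -> f z = f w -> z = w.

Definition range_of_disk (f : C -> C) (w : C) : Prop :=
  exists z : C, disk z /\ w = f z.

Definition connected_set (A : C -> Prop) : Prop :=
  ~ exists U V : C -> Prop,
      open U /\ open V /\
      (forall z, A z -> U z \/ V z) /\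
      (forall z, ~ (A z /\ U z /\ V z)) /\
      (exists z, A z /\ U z) /\
      (exists z, A z /\ V z).

(* The empty set is connected for [connected_set]. *)
Definition convex_in_horizontal_direction (Omega : C -> Prop) : Prop :=
  forall y : R, connected_set (fun z : C => Omega z /\ Im z = y).

(* [harmonic_shear phi q h g]: the harmonic mapping f = h + conj g is the
   horizontal shear of [phi] with dilatation q^2.  The relation g'/h' = q^2 is
   written without division; when phi' <> 0 and |q| < 1 it gives h' <> 0,
   because then phi' = h' - g' = (1 - q^2) h'. *)
Definition harmonic_shear (phi q h g : C -> C) : Prop :=
  analytic_in_disk h /\ analytic_in_disk g /\
  (forall z : C, disk z -> (h z - g z)%C = phi z) /\
  (forall z : C, disk z -> C_derive g z = (q z ^ 2 * C_derive h z)%C).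

Definition partial_x (F : C -> C) (z : C) : C :=
  (Derive (fun t : R => Re (F (t, Im z))) (Re z),
   Derive (fun t : R => Im (F (t, Im z))) (Re z)).

Definition partial_y (F : C -> C) (z : C) : C :=
  (Derive (fun t : R => Re (F (Re z, t))) (Im z),
   Derive (fun t : R => Im (F (Re z, t))) (Im z)).

Definition wirtinger (F : C -> C) (z : C) : C :=
  (/ 2 * (partial_x F z - Ci * partial_y F z))%C.

(* Like [schwarzian] and [schwarzian_norm] below, this is attached to the
   harmonic mapping f = h + conj g; it depends only on h' and g', hence not on
   the additive constants in [h] and [g]. *)
Definition sigma (h g : C -> C) (z : C) : C :=
  RtoC (ln (Cmod (C_derive h z) + Cmod (C_derive g z))).

Definition schwarzian (h g : C -> C) (z : C) : C :=
  (2 * (wirtinger (wirtinger (sigma h g)) z - wirtinger (sigma h g) z ^ 2))%C.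

Definition schwarzian_norm (h g : C -> C) : Rbar :=
  Lub_Rbar (fun r : R => exists z : C,
    disk z /\ r = (1 - Cmod z ^ 2) ^ 2 * Cmod (schwarzian h g z)).

(* Main.v *)
Require Import Defs.
From Stdlib Require Import Lra Lia Psatz Classical ClassicalEpsilon.

(** A direct computation gives, with [P = h'' / h'] and
    [s = conj q / (1 + |q|^2)],

      [S f = P' - P^2 / 2 + 2 s (q'' - q' P) - 4 (q' s)^2]

    ([schwarzian_formula]).  Since [|s| <= 1], the norm is finite as soon as [P]
    and [q'] are [O (1 / (1 - |z|))] in the disk: Cauchy estimates on the disk
    of radius [(1 - |z|) / 2] about [z] then bound [P'] and [q''] by
    [O (1 / (1 - |z|)^2)] ([derivative_growth]).  The bound on [q'] is the
    Schwarz-Pick inequality [schwarz_pick].  As [phi' = (1 - q^2) h'],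

      [P = phi'' / phi' + 2 q q' / (1 - q^2)],

    and Schwarz-Pick controls the last term too, because
    [|1 - q^2| >= 1 - |q|^2].  What remains is
    [phi'' / phi' = O (1 / (1 - |z|))] ([pre_schwarzian_bound]).

    A univalent function [phi] omits a value [w] with
    [|w - phi b| <= 4 (1 - |b|) |phi' b|] ([omitted_value_near]).  Convexity in
    the horizontal direction forces [phi] to omit one of the two horizontal
    rays that start at [w], so that [w - phi] or [phi - w] avoids the
    nonpositive reals and has a holomorphic square root [G] of positive real
    part.  Such a [G] satisfies [|G'| <= 2 Re G / r] and
    [|G''| <= 8 Re G / r^2] at the centre of a disk of radius [r]
    ([half_plane_derivative], [half_plane_second_derivative]).  The estimate
    then follows from [phi'' / phi' = G' / G + G'' / G'], where the closeness of
    the omitted value is what bounds [G'] from below.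

    The function theory rests on complex differentiability alone.  Goursat's
    subdivision argument on rectangles, applied to [f (a + exp z)], shows that
    the mean of [f] over the circle of radius [r] about [a] does not depend on
    [r] ([circle_mean_indep]).  As the argument stays away from [a], the mean
    value property [mean_value] covers functions that are merely continuous at
    the centre; applied to difference quotients it gives the
    integral formula [cauchy_derivative] for [f'], hence the holomorphy of [f']
    ([holo_ball_derive]), and applied to their reciprocals it gives the
    distortion facts about univalent functions. *)

Local Notation is_Cderive := (@is_derive C_AbsRing C_NormedModule).
Local Notation ex_Cderive := (@ex_derive C_AbsRing C_NormedModule).
Local Notation Ccontinuous := (@continuous C_UniformSpace C_UniformSpace).
Local Notation Rcurve_continuous := (@continuous R_UniformSpace C_UniformSpace).
Local Notation CRInt := (@RInt C_R_CompleteNormedModule).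
Local Notation is_CRInt := (@is_RInt C_R_NormedModule).

(** * Complex differentiability and continuity by epsilon and delta *)

(** The filter-based derivative is a statement about the absolute-value topology of the
    scalars, while continuity and integration of curves use the product topology of the
    plane; the epsilon-delta form mediates between the two. *)
Lemma is_Cderive_eps (f : C -> C) (z l : C) :
  is_Cderive f z l <->
  (forall eps, 0 < eps -> exists d, 0 < d /\
     forall w : C, Cmod (w - z) < d ->
       Cmod (f w - f z - l * (w - z)) <= eps * Cmod (w - z)).
Proof.
split.
- intros [_ H] eps Heps.
  destruct (H z (fun P Q => Q) (mkposreal eps Heps)) as [d Hd].
  exists d; split; [apply cond_pos|].
  intros w Hw; specialize (Hd w Hw); simpl in Hd.
  rewrite (Cmult_comm l). exact Hd.
- intros H; split; [apply is_linear_scal_l|].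
  intros x Hx eps.
  assert (Hz : x = z).
  { symmetry; exact (is_filter_lim_locally_unique (V := AbsRing_NormedModule C_AbsRing) z x Hx). }
  subst x.
  destruct (H eps (cond_pos eps)) as [d [Hd Hw]].
  exists (mkposreal d Hd); intros w Hb.
  specialize (Hw w Hb). rewrite (Cmult_comm l) in Hw. exact Hw.
Qed.

Lemma Cmod_minus_sym (a b : C) : Cmod (a - b) = Cmod (b - a).
Proof. rewrite <- Cmod_opp; f_equal; ring. Qed.

Lemma Cmod_triangle_sub (a b : C) : Cmod a <= Cmod b + Cmod (a - b).
Proof.
replace a with (b + (a - b))%C at 1 by ring. apply Cmod_triangle.
Qed.

Lemma Cmod_minus_le (a b : C) : Cmod (a - b) <= Cmod a + Cmod b.
Proof. unfold Cminus. rewrite <- (Cmod_opp b). apply Cmod_triangle. Qed.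

Lemma Re_le_Cmod (z : C) : Rabs (Re z) <= Cmod z.
Proof. eapply Rle_trans; [apply Rmax_l | apply Rmax_Cmod]. Qed.

Lemma Im_le_Cmod (z : C) : Rabs (Im z) <= Cmod z.
Proof. eapply Rle_trans; [apply Rmax_r | apply Rmax_Cmod]. Qed.

Lemma Cmod_le_Re_Im (z : C) : Cmod z <= Rabs (Re z) + Rabs (Im z).
Proof.
replace z with (RtoC (Re z) + RtoC (Im z) * Ci)%C
  by (destruct z; unfold Re, Im, RtoC, Ci, Cmult, Cplus; simpl; f_equal; ring).
eapply Rle_trans; [apply Cmod_triangle|].
rewrite Cmod_mult, !Cmod_R, Cmod_Ci.
destruct z; unfold Re, Im, RtoC, Ci, Cmult, Cplus; simpl.
right; f_equal; [f_equal | rewrite Rmult_1_r; f_equal]; ring.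
Qed.

Lemma Cmod_sqr (z : C) : Cmod z ^ 2 = Re z ^ 2 + Im z ^ 2.
Proof.
unfold Cmod. rewrite pow2_sqrt; [reflexivity|].
generalize (pow2_ge_0 (fst z)) (pow2_ge_0 (snd z)); lra.
Qed.

Lemma Ccontinuous_eps (f : C -> C) (z : C) :
  Ccontinuous f z <->
  (forall eps, 0 < eps -> exists d, 0 < d /\
     forall w : C, Cmod (w - z) < d -> Cmod (f w - f z) < eps).
Proof.
split.
- intros H eps Heps.
  assert (He : 0 < eps / 2) by lra.
  assert (HH := H (ball (f z) (mkposreal _ He)) (locally_ball _ _)).
  destruct HH as [d Hd]. exists d; split; [apply cond_pos|].
  intros w Hw.
  destruct (Hd w) as [H1 H2].
  { split; unfold ball; simpl; unfold AbsRing_ball, abs, minus, plus, opp; simpl.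
    - apply Rle_lt_trans with (2 := Hw). apply (Re_le_Cmod (w - z)).
    - apply Rle_lt_trans with (2 := Hw). apply (Im_le_Cmod (w - z)). }
  eapply Rle_lt_trans; [apply Cmod_le_Re_Im|].
  unfold ball in H1, H2; simpl in H1, H2.
  unfold AbsRing_ball, abs, minus, plus, opp in H1, H2; simpl in H1, H2.
  unfold Re, Im, Cminus, Cplus, Copp; simpl. lra.
- intros H P [eps HP].
  destruct (H eps (cond_pos eps)) as [d [Hd Hw]].
  assert (He : 0 < d / 2) by lra.
  exists (mkposreal _ He); intros w [H1 H2]. apply HP.
  unfold ball in H1, H2; simpl in H1, H2.
  unfold AbsRing_ball, abs, minus, plus, opp in H1, H2; simpl in H1, H2.
  specialize (Hw w). assert (Hc : Cmod (w - z) < d).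
  { eapply Rle_lt_trans; [apply Cmod_le_Re_Im|].
    unfold Re, Im, Cminus, Cplus, Copp; simpl. lra. }
  specialize (Hw Hc).
  split; unfold ball; simpl; unfold AbsRing_ball, abs, minus, plus, opp; simpl.
    + apply Rle_lt_trans with (2 := Hw). apply (Re_le_Cmod (f w - f z)).
    + apply Rle_lt_trans with (2 := Hw). apply (Im_le_Cmod (f w - f z)).
Qed.

Lemma is_Cderive_lipschitz (f : C -> C) (z l : C) :
  is_Cderive f z l -> exists d, 0 < d /\ forall w : C, Cmod (w - z) < d ->
    Cmod (f w - f z) <= (Cmod l + 1) * Cmod (w - z).
Proof.
intros H. destruct (proj1 (is_Cderive_eps _ _ _) H 1 Rlt_0_1) as [d [Hd Hw]].
exists d; split; [exact Hd|]. intros w Hwd. specialize (Hw w Hwd).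
eapply Rle_trans; [apply (Cmod_triangle_sub _ (l * (w - z)))|].
rewrite Cmod_mult. lra.
Qed.

Lemma is_Cderive_continuous (f : C -> C) (z l : C) :
  is_Cderive f z l -> Ccontinuous f z.
Proof.
intros H; apply Ccontinuous_eps; intros eps Heps.
destruct (is_Cderive_lipschitz _ _ _ H) as [d [Hd Hw]].
assert (0 <= Cmod l) by apply Cmod_ge_0.
assert (0 < eps / (Cmod l + 1)) by (apply Rdiv_lt_0_compat; lra).
exists (Rmin d (eps / (Cmod l + 1))); split; [now apply Rmin_pos|].
intros w Hm.
eapply Rle_lt_trans; [apply Hw; eapply Rlt_le_trans; [exact Hm | apply Rmin_l]|].
apply Rlt_le_trans with ((Cmod l + 1) * (eps / (Cmod l + 1))).
- apply Rmult_lt_compat_l; [lra|]. eapply Rlt_le_trans; [exact Hm | apply Rmin_r].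
- right; field; lra.
Qed.

Lemma is_Cderive_eq (f : C -> C) (z l m : C) :
  is_Cderive f z l -> l = m -> is_Cderive f z m.
Proof. now intros H <-. Qed.

Lemma is_Cderive_const (c z : C) : is_Cderive (fun _ => c) z (RtoC 0).
Proof. exact (is_derive_const (V := C_NormedModule) c z). Qed.

Lemma is_Cderive_id (z : C) : is_Cderive (fun w => w) z (RtoC 1).
Proof.
apply is_Cderive_eps; intros eps Heps; exists 1; split; [lra|]; intros w _.
replace (w - z - RtoC 1 * (w - z))%C with (RtoC 0) by ring.
rewrite Cmod_0. apply Rmult_le_pos; [lra | apply Cmod_ge_0].
Qed.

Lemma is_Cderive_plus (f g : C -> C) (z l m : C) :
  is_Cderive f z l -> is_Cderive g z m ->
  is_Cderive (fun w => f w + g w)%C z (l + m)%C.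
Proof. exact (is_derive_plus (V := C_NormedModule) f g z l m). Qed.

Lemma is_Cderive_minus (f g : C -> C) (z l m : C) :
  is_Cderive f z l -> is_Cderive g z m ->
  is_Cderive (fun w => f w - g w)%C z (l - m)%C.
Proof. exact (is_derive_minus (V := C_NormedModule) f g z l m). Qed.

Lemma is_Cderive_mult (f g : C -> C) (z l m : C) :
  is_Cderive f z l -> is_Cderive g z m ->
  is_Cderive (fun w => f w * g w)%C z (l * g z + f z * m)%C.
Proof.
intros Hf Hg; apply is_Cderive_eps; intros eps Heps.
assert (Hlf := is_Cderive_lipschitz _ _ _ Hf).
destruct Hlf as [d1 [Hd1 H1]].
set (A := Cmod l + 1) in *.
assert (HA : 0 < A) by (unfold A; generalize (Cmod_ge_0 l); lra).
set (B := Cmod (g z) + 1).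
assert (HB : 0 < B) by (unfold B; generalize (Cmod_ge_0 (g z)); lra).
set (F := Cmod (f z) + 1).
assert (HF : 0 < F) by (unfold F; generalize (Cmod_ge_0 (f z)); lra).
destruct (proj1 (is_Cderive_eps _ _ _) Hf (eps / (3 * B)) ltac:(apply Rdiv_lt_0_compat; lra))
  as [d2 [Hd2 H2]].
destruct (proj1 (is_Cderive_eps _ _ _) Hg (eps / (3 * F)) ltac:(apply Rdiv_lt_0_compat; lra))
  as [d3 [Hd3 H3]].
destruct (proj1 (Ccontinuous_eps _ _) (is_Cderive_continuous _ _ _ Hg) (eps / (3 * A))
  ltac:(apply Rdiv_lt_0_compat; lra)) as [d4 [Hd4 H4]].
exists (Rmin (Rmin d1 d2) (Rmin d3 d4)); split.
{ now repeat apply Rmin_pos. }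
intros w Hw.
assert (Hm1 := Rmin_l (Rmin d1 d2) (Rmin d3 d4)).
assert (Hm2 := Rmin_r (Rmin d1 d2) (Rmin d3 d4)).
assert (Hm3 := Rmin_l d1 d2). assert (Hm4 := Rmin_r d1 d2).
assert (Hm5 := Rmin_l d3 d4). assert (Hm6 := Rmin_r d3 d4).
specialize (H1 w ltac:(lra)). specialize (H2 w ltac:(lra)).
specialize (H3 w ltac:(lra)). specialize (H4 w ltac:(lra)).
replace (f w * g w - f z * g z - (l * g z + f z * m) * (w - z))%C with
  ((f w - f z) * (g w - g z) + (g z * (f w - f z - l * (w - z))
    + f z * (g w - g z - m * (w - z))))%C by ring.
set (x := Cmod (w - z)) in *. assert (Hx : 0 <= x) by apply Cmod_ge_0.
eapply Rle_trans; [apply Cmod_triangle|].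
eapply Rle_trans; [apply Rplus_le_compat_l, Cmod_triangle|].
rewrite !Cmod_mult.
assert (E1 : Cmod (f w - f z) * Cmod (g w - g z) <= (A * x) * (eps / (3 * A))).
{ apply Rmult_le_compat; try apply Cmod_ge_0; lra. }
assert (E2 : Cmod (g z) * Cmod (f w - f z - l * (w - z)) <= B * (eps / (3 * B) * x)).
{ apply Rmult_le_compat; try apply Cmod_ge_0; [unfold B; lra | lra]. }
assert (E3 : Cmod (f z) * Cmod (g w - g z - m * (w - z)) <= F * (eps / (3 * F) * x)).
{ apply Rmult_le_compat; try apply Cmod_ge_0; [unfold F; lra | lra]. }
replace ((A * x) * (eps / (3 * A))) with (eps * x / 3) in E1 by (field; lra).
replace (B * (eps / (3 * B) * x)) with (eps * x / 3) in E2 by (field; lra).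
replace (F * (eps / (3 * F) * x)) with (eps * x / 3) in E3 by (field; lra).
lra.
Qed.

Lemma is_Cderive_comp (f g : C -> C) (z l m : C) :
  is_Cderive f (g z) l -> is_Cderive g z m ->
  is_Cderive (fun w => f (g w)) z (l * m)%C.
Proof.
intros Hf Hg; apply is_Cderive_eps; intros eps Heps.
destruct (is_Cderive_lipschitz _ _ _ Hg) as [d1 [Hd1 H1]].
set (A := Cmod m + 1) in *.
assert (HA : 0 < A) by (unfold A; generalize (Cmod_ge_0 m); lra).
set (B := Cmod l + 1).
assert (HB : 0 < B) by (unfold B; generalize (Cmod_ge_0 l); lra).
destruct (proj1 (is_Cderive_eps _ _ _) Hf (eps / (2 * A)) ltac:(apply Rdiv_lt_0_compat; lra))
  as [d2 [Hd2 H2]].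
destruct (proj1 (is_Cderive_eps _ _ _) Hg (eps / (2 * B)) ltac:(apply Rdiv_lt_0_compat; lra))
  as [d3 [Hd3 H3]].
destruct (proj1 (Ccontinuous_eps _ _) (is_Cderive_continuous _ _ _ Hg) d2 Hd2) as [d4 [Hd4 H4]].
exists (Rmin d1 (Rmin d3 d4)); split.
{ now repeat apply Rmin_pos. }
intros w Hw.
assert (Hm1 := Rmin_l d1 (Rmin d3 d4)).
assert (Hm2 := Rmin_r d1 (Rmin d3 d4)).
assert (Hm5 := Rmin_l d3 d4). assert (Hm6 := Rmin_r d3 d4).
specialize (H1 w ltac:(lra)). specialize (H3 w ltac:(lra)). specialize (H4 w ltac:(lra)).
specialize (H2 (g w) H4).
replace (f (g w) - f (g z) - l * m * (w - z))%C with
  ((f (g w) - f (g z) - l * (g w - g z)) + l * (g w - g z - m * (w - z)))%C by ring.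
set (x := Cmod (w - z)) in *. assert (Hx : 0 <= x) by apply Cmod_ge_0.
eapply Rle_trans; [apply Cmod_triangle|]. rewrite Cmod_mult.
assert (E1 : eps / (2 * A) * Cmod (g w - g z) <= eps / (2 * A) * (A * x)).
{ apply Rmult_le_compat_l; [|lra]. apply Rlt_le, Rdiv_lt_0_compat; lra. }
assert (E2 : Cmod l * Cmod (g w - g z - m * (w - z)) <= B * (eps / (2 * B) * x)).
{ apply Rmult_le_compat; try apply Cmod_ge_0; [unfold B; lra | lra]. }
replace (eps / (2 * A) * (A * x)) with (eps * x / 2) in E1 by (field; lra).
replace (B * (eps / (2 * B) * x)) with (eps * x / 2) in E2 by (field; lra).
lra.
Qed.

Lemma is_Cderive_inv_id (z : C) : z <> 0%C ->
  is_Cderive (fun w => / w)%C z (- / (z * z))%C.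
Proof.
intros Hz. apply is_Cderive_eps; intros eps Heps.
assert (Hc : 0 < Cmod z) by now apply Cmod_gt_0.
set (c := Cmod z) in *.
exists (Rmin (c / 2) (eps * (c * c * c) / 2)); split.
{ apply Rmin_pos; [lra|]. apply Rdiv_lt_0_compat; [|lra].
  repeat (apply Rmult_lt_0_compat; try lra). }
intros w Hw.
assert (Hm1 := Rmin_l (c / 2) (eps * (c * c * c) / 2)).
assert (Hm2 := Rmin_r (c / 2) (eps * (c * c * c) / 2)).
assert (Hcw : c / 2 <= Cmod w).
{ generalize (Cmod_triangle_sub z w); rewrite (Cmod_minus_sym z w); fold c; lra. }
assert (Hw0 : w <> 0%C) by (apply Cmod_gt_0; lra).
replace (/ w - / z - - / (z * z) * (w - z))%C with ((w - z) * ((w - z) / (w * (z * z))))%C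
  by (field; auto).
rewrite Cmod_mult, Rmult_comm. apply Rmult_le_compat_r; [apply Cmod_ge_0|].
rewrite Cmod_div by (repeat apply Cmult_neq_0; auto).
rewrite !Cmod_mult. fold c.
apply Rle_div_l; [repeat apply Rmult_lt_0_compat; lra|].
apply Rle_trans with (eps * (c / 2 * (c * c))).
- lra.
- apply Rmult_le_compat_l; [lra|]. apply Rmult_le_compat_r; [|exact Hcw].
  apply Rmult_le_pos; lra.
Qed.

Lemma is_Cderive_inv (f : C -> C) (z l : C) :
  f z <> 0%C -> is_Cderive f z l ->
  is_Cderive (fun w => / f w)%C z (- l / (f z * f z))%C.
Proof.
intros Hz Hf.
replace (- l / (f z * f z))%C with (- / (f z * f z) * l)%C by (field; auto).
apply (is_Cderive_comp (fun w => / w)%C f); [now apply is_Cderive_inv_id | exact Hf].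
Qed.

Lemma is_Cderive_div (f g : C -> C) (z l m : C) :
  g z <> 0%C -> is_Cderive f z l -> is_Cderive g z m ->
  is_Cderive (fun w => f w / g w)%C z ((l * g z - f z * m) / (g z * g z))%C.
Proof.
intros Hz Hf Hg.
replace ((l * g z - f z * m) / (g z * g z))%C with
  (l * / g z + f z * (- m / (g z * g z)))%C by (field; auto).
apply (is_Cderive_mult f (fun w => / g w)%C); [exact Hf | now apply is_Cderive_inv].
Qed.

Lemma is_Cderive_ext_ball (f g : C -> C) (z l : C) (r : R) :
  0 < r -> (forall w : C, Cmod (w - z) < r -> f w = g w) ->
  is_Cderive f z l -> is_Cderive g z l.
Proof.
intros Hr He Hf. apply is_Cderive_eps; intros eps Heps.
destruct (proj1 (is_Cderive_eps _ _ _) Hf eps Heps) as [d [Hd H]].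
exists (Rmin d r); split; [now apply Rmin_pos|]. intros w Hw.
rewrite <- !He; [apply H| |].
- eapply Rlt_le_trans; [exact Hw | apply Rmin_l].
- replace (z - z)%C with (RtoC 0) by ring. now rewrite Cmod_0.
- eapply Rlt_le_trans; [exact Hw | apply Rmin_r].
Qed.

Lemma C_derive_is (f : C -> C) (z : C) :
  (@ex_derive C_AbsRing C_NormedModule f z) -> is_Cderive f z (C_derive f z).
Proof. intros H; now apply C_derive_correct. Qed.

Lemma Rcurve_continuous_iff (u : R -> C) (t : R) :
  Rcurve_continuous u t <->
  continuous (fun s => Re (u s)) t /\ continuous (fun s => Im (u s)) t.
Proof.
split.
- intros H; split.
  + apply (continuous_comp u fst); [exact H | apply continuous_fst].
  + apply (continuous_comp u snd); [exact H | apply continuous_snd].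
- intros [H1 H2].
  apply continuous_ext with (f := fun s => (Re (u s), Im (u s)) : C).
  { intros s; now destruct (u s). }
  apply (filterlim_filter_le_2 _ (G := filter_prod (locally (Re (u t))) (locally (Im (u t))))).
  { destruct (u t) as [a b]. unfold Re, Im; simpl.
    intros P [e HP]. apply Filter_prod with (ball a e) (ball b e); try apply locally_ball.
    intros x y Hx Hy. apply HP. split; assumption. }
  apply filterlim_pair; assumption.
Qed.

(** * Goursat's theorem on rectangles *)

Lemma norm_C_R (z : C) : @norm R_AbsRing C_R_NormedModule z = Cmod z.
Proof.
unfold Cmod, norm; simpl. unfold prod_norm, norm; simpl. unfold abs; simpl.
f_equal. rewrite <- !(Rmult_assoc _ _ 1), !Rmult_1_r, <- !Rabs_mult.
rewrite !Rabs_pos_eq; try apply Rle_0_sqr. reflexivity.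
Qed.

Lemma is_CRInt_continuous (u : R -> C) (a b : R) : a <= b ->
  (forall t, a <= t <= b -> Rcurve_continuous u t) -> is_CRInt u a b (CRInt u a b).
Proof.
intros Hab Hu. apply (RInt_correct (V := C_R_CompleteNormedModule)).
apply (ex_RInt_continuous (V := C_R_CompleteNormedModule)).
intros t Ht. rewrite Rmin_left, Rmax_right in Ht by lra. now apply Hu.
Qed.

Lemma CRInt_near_const (u : R -> C) (a b M : R) (c l : C) : a <= b ->
  is_CRInt u a b l ->
  (forall t, a <= t <= b -> Cmod (u t - c) <= M) ->
  Cmod (l - RtoC (b - a) * c) <= (b - a) * M.
Proof.
intros Hab Hu HM.
rewrite <- norm_C_R.
apply (norm_RInt_le (V := C_R_NormedModule) (fun t => u t - c)%C (fun _ => M) a b); auto.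
- intros t Ht. rewrite norm_C_R. now apply HM.
- rewrite <- scal_R_Cmult.
  apply (is_RInt_minus (V := C_R_NormedModule) u (fun _ => c)); [exact Hu|].
  apply (is_RInt_const (V := C_R_NormedModule)).
- exact (is_RInt_const a b M).
Qed.

(** The supremum of the left endpoints lies below every right endpoint. *)
Lemma nested_intervals_point (x s : nat -> R) :
  (forall n, 0 <= s n) ->
  (forall n, x n <= x (S n) /\ x (S n) + s (S n) <= x n + s n) ->
  exists u, forall n, x n <= u <= x n + s n.
Proof.
intros Hs H.
assert (Hm : forall n k, x n <= x (n + k)%nat /\ x (n + k)%nat + s (n + k)%nat <= x n + s n).
{ intros n k; induction k as [|k IH].
  - rewrite Nat.add_0_r; lra.
  - rewrite Nat.add_succ_r. generalize (H (n + k)%nat); lra. }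
assert (Hb : forall n m, x n <= x m + s m).
{ intros n m. destruct (Nat.le_ge_cases n m) as [L|L].
  - replace m with (n + (m - n))%nat by lia.
    generalize (Hm n (m - n)%nat) (Hs (n + (m - n))%nat); lra.
  - replace n with (m + (n - m))%nat by lia.
    generalize (Hm m (n - m)%nat) (Hs (m + (n - m))%nat); lra. }
destruct (completeness (fun y => exists n, y = x n)) as [u [Hu1 Hu2]].
- exists (x O + s O). intros y [n ->]. apply Hb.
- exists (x O), O; reflexivity.
- exists u; intros n; split.
  + apply Hu1; now exists n.
  + apply Hu2. intros y [k ->]. apply Hb.
Qed.

(** If [A] were positive on the rectangle, one of the four quarters would carry at least a
    quarter of its value, and so on; the quarters shrink to a point, where the local
    estimate, quadratic in the size, contradicts the lower bound [A0 / 4 ^ n]. *)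
Lemma rectangle_subdivision (A : R -> R -> R -> R -> R) (x0 y0 a b : R) :
  0 < a -> 0 < b ->
  (forall x y s t, 0 < s -> 0 < t -> x0 <= x -> x + s <= x0 + a -> y0 <= y -> y + t <= y0 + b ->
     A x y s t <= A x y (s/2) (t/2) + A (x + s/2) y (s/2) (t/2)
       + A x (y + t/2) (s/2) (t/2) + A (x + s/2) (y + t/2) (s/2) (t/2)) ->
  (forall u v eps, x0 <= u <= x0 + a -> y0 <= v <= y0 + b -> 0 < eps ->
     exists d, 0 < d /\ forall x y s t, 0 < s < d -> 0 < t < d ->
       x0 <= x -> x + s <= x0 + a -> y0 <= y -> y + t <= y0 + b ->
       x <= u <= x + s -> y <= v <= y + t -> A x y s t <= eps * (s + t) ^ 2) ->
  A x0 y0 a b <= 0.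
Proof.
intros Ha Hb Hadd Hloc.
apply Rnot_lt_le; intros Hpos.
set (A0 := A x0 y0 a b) in *.
(* One step keeps the lower left corner of a quarter that carries enough of [A]. *)
set (step := fun (s t : R) (p : R * R) =>
  let x := fst p in let y := snd p in
  let m := A x y s t / 4 in
  if Rle_dec m (A x y (s/2) (t/2)) then (x, y) else
  if Rle_dec m (A (x + s/2) y (s/2) (t/2)) then (x + s/2, y) else
  if Rle_dec m (A x (y + t/2) (s/2) (t/2)) then (x, y + t/2) else (x + s/2, y + t/2)).
set (p := fix p (n : nat) : R * R :=
  match n with O => (x0, y0) | S k => step (a / 2 ^ k) (b / 2 ^ k) (p k) end).
set (s := fun n => a / 2 ^ n). set (t := fun n => b / 2 ^ n).
assert (H2 : forall n, 0 < 2 ^ n) by (intros; apply pow_lt; lra).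
assert (Hs : forall n, 0 < s n) by (intros; now apply Rdiv_lt_0_compat).
assert (Ht : forall n, 0 < t n) by (intros; now apply Rdiv_lt_0_compat).
assert (Hs' : forall n, s (S n) = s n / 2).
{ intros n; unfold s; simpl; field. apply Rgt_not_eq, H2. }
assert (Ht' : forall n, t (S n) = t n / 2).
{ intros n; unfold t; simpl; field. apply Rgt_not_eq, H2. }
assert (Hnest : forall n, fst (p n) <= fst (p (S n)) /\
   fst (p (S n)) + s (S n) <= fst (p n) + s n /\
   snd (p n) <= snd (p (S n)) /\ snd (p (S n)) + t (S n) <= snd (p n) + t n).
{ intros n. rewrite Hs', Ht'. generalize (Hs n) (Ht n).
  simpl. fold (s n) (t n). unfold step.
  repeat destruct Rle_dec; simpl; intros; repeat split; lra. }
assert (Hin : forall n, x0 <= fst (p n) /\ fst (p n) + s n <= x0 + a /\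
   y0 <= snd (p n) /\ snd (p n) + t n <= y0 + b).
{ induction n as [|n IH].
  - unfold s, t; simpl. repeat split; lra.
  - generalize (Hnest n); lra. }
assert (HA : forall n, A0 / 4 ^ n <= A (fst (p n)) (snd (p n)) (s n) (t n)).
{ induction n as [|n IH].
  - unfold s, t; simpl. rewrite !Rdiv_1_r. fold A0; lra.
  - replace (A0 / 4 ^ S n) with (A0 / 4 ^ n / 4)
      by (simpl; field; apply pow_nonzero; lra).
    rewrite Hs', Ht'.
    destruct (Hin n) as [I1 [I2 [I3 I4]]].
    generalize (Hadd (fst (p n)) (snd (p n)) (s n) (t n) (Hs n) (Ht n) I1 I2 I3 I4).
    simpl. fold (s n) (t n). unfold step.
    repeat destruct Rle_dec; simpl; lra. }
destruct (nested_intervals_point (fun n => fst (p n)) s) as [u Hu].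
{ intros; now apply Rlt_le. }
{ intros n; generalize (Hnest n); lra. }
destruct (nested_intervals_point (fun n => snd (p n)) t) as [v Hv].
{ intros; now apply Rlt_le. }
{ intros n; generalize (Hnest n); lra. }
assert (Hab : 0 < (a + b) ^ 2) by (apply pow_lt; lra).
destruct (Hloc u v (A0 / (2 * (a + b) ^ 2))) as [d [Hd HH]].
{ generalize (Hu O); unfold s; simpl; rewrite Rdiv_1_r; lra. }
{ generalize (Hv O); unfold t; simpl; rewrite Rdiv_1_r; lra. }
{ apply Rdiv_lt_0_compat; lra. }
destruct (pow_lt_1_zero (/ 2) ltac:(rewrite Rabs_pos_eq; lra) (d / (a + b))) as [N HN].
{ apply Rdiv_lt_0_compat; lra. }
specialize (HN N (le_n N)).
rewrite Rabs_pos_eq, pow_inv in HN by (apply pow_le; lra).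
assert (Hd2 : (a + b) / 2 ^ N < d).
{ replace d with ((a + b) * (d / (a + b))) by (field; lra).
  apply Rmult_lt_compat_l; [lra | exact HN]. }
replace ((a + b) / 2 ^ N) with (s N + t N) in Hd2 by (unfold s, t; field; apply Rgt_not_eq, H2).
destruct (Hin N) as [I1 [I2 [I3 I4]]].
generalize (Hs N) (Ht N); intros HsN HtN.
specialize (HH (fst (p N)) (snd (p N)) (s N) (t N) ltac:(lra) ltac:(lra) I1 I2 I3 I4 (Hu N) (Hv N)).
specialize (HA N).
replace (A0 / (2 * (a + b) ^ 2) * (s N + t N) ^ 2) with (A0 / 4 ^ N / 2) in HH.
- assert (0 < A0 / 4 ^ N) by (apply Rdiv_lt_0_compat; [lra | apply pow_lt; lra]). lra.
- unfold s, t. replace (4 ^ N) with (2 ^ N * 2 ^ N)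
    by (rewrite <- Rpow_mult_distr; f_equal; lra).
  field. split; [apply Rgt_not_eq, H2 | lra].
Qed.

Lemma Rcurve_continuous_comp (f : C -> C) (g : R -> C) (t : R) :
  Rcurve_continuous g t -> Ccontinuous f (g t) -> Rcurve_continuous (fun s => f (g s)) t.
Proof. intros H1 H2. exact (continuous_comp g f t H1 H2). Qed.

(** Boundary integrals add up under subdivision into quarters.  Near a point where [G] is
    differentiable they are quadratically small, because the affine part of [G] contributes
    nothing. *)
Lemma goursat (G : C -> C) (x0 y0 a b : R) :
  0 < a -> 0 < b ->
  (forall u v, x0 <= u <= x0 + a -> y0 <= v <= y0 + b -> exists l, is_Cderive G (u, v) l) ->
  (Ci * (CRInt (fun y => G ((x0 + a)%R, y)) y0 (y0 + b) - CRInt (fun y => G (x0, y)) y0 (y0 + b)))%C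
  = (CRInt (fun x => G (x, (y0 + b)%R)) x0 (x0 + a) - CRInt (fun x => G (x, y0)) x0 (x0 + a))%C.
Proof.
intros Ha Hb HG.
set (V := fun x y t => CRInt (fun v => G (x, v)) y (y + t)).
set (H := fun y x s => CRInt (fun u => G (u, y)) x (x + s)).
set (B := fun x y s t : R => (Ci * (V (x + s)%R y t - V x y t) - (H (y + t)%R x s - H y x s))%C).
assert (HV : forall x y t, 0 <= t -> x0 <= x <= x0 + a -> y0 <= y -> y + t <= y0 + b ->
  is_CRInt (fun v => G (x, v)) y (y + t) (V x y t)).
{ intros x y t Ht Hx Hy Hyt. apply is_CRInt_continuous; [lra|].
  intros v Hv. destruct (HG x v Hx ltac:(lra)) as [l Hl].
  apply (Rcurve_continuous_comp G (fun v => (x, v))).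
  - apply Rcurve_continuous_iff; split; simpl; [apply continuous_const | apply continuous_id].
  - now apply is_Cderive_continuous with l. }
assert (HH : forall y x s, 0 <= s -> y0 <= y <= y0 + b -> x0 <= x -> x + s <= x0 + a ->
  is_CRInt (fun u => G (u, y)) x (x + s) (H y x s)).
{ intros y x s Hs Hy Hx Hxs. apply is_CRInt_continuous; [lra|].
  intros u Hu. destruct (HG u y ltac:(lra) Hy) as [l Hl].
  apply (Rcurve_continuous_comp G (fun u => (u, y))).
  - apply Rcurve_continuous_iff; split; simpl; [apply continuous_id | apply continuous_const].
  - now apply is_Cderive_continuous with l. }
assert (HVc : forall x y t, 0 <= t -> x0 <= x <= x0 + a -> y0 <= y -> y + t <= y0 + b ->
  V x y t = (V x y (t/2)%R + V x (y + t/2)%R (t/2)%R)%C).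
{ intros x y t Ht Hx Hy Hyt.
  apply (is_RInt_unique (V := C_R_CompleteNormedModule)).
  apply (is_RInt_Chasles (V := C_R_NormedModule)) with (y + t/2).
  - apply HV; lra.
  - replace (y + t) with (y + t/2 + t/2) by field. apply HV; lra. }
assert (HHc : forall y x s, 0 <= s -> y0 <= y <= y0 + b -> x0 <= x -> x + s <= x0 + a ->
  H y x s = (H y x (s/2)%R + H y (x + s/2)%R (s/2)%R)%C).
{ intros y x s Hs Hy Hx Hxs.
  apply (is_RInt_unique (V := C_R_CompleteNormedModule)).
  apply (is_RInt_Chasles (V := C_R_NormedModule)) with (x + s/2).
  - apply HH; lra.
  - replace (x + s) with (x + s/2 + s/2) by field. apply HH; lra. }
assert (HB : Cmod (B x0 y0 a b) <= 0).
{ apply (rectangle_subdivision (fun x y s t => Cmod (B x y s t))); auto.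
  - intros x y s t Hs Ht Hx1 Hx2 Hy1 Hy2.
    replace (B x y s t) with (B x y (s/2)%R (t/2)%R + B (x + s/2)%R y (s/2)%R (t/2)%R
       + B x (y + t/2)%R (s/2)%R (t/2)%R + B (x + s/2)%R (y + t/2)%R (s/2)%R (t/2)%R)%C.
    + eapply Rle_trans; [apply Cmod_triangle|]. apply Rplus_le_compat_r.
      eapply Rle_trans; [apply Cmod_triangle|]. apply Rplus_le_compat_r.
      apply Cmod_triangle.
    + unfold B. rewrite (HVc (x + s) y t), (HVc x y t), (HHc (y + t) x s), (HHc y x s) by lra.
      replace (x + s/2 + s/2) with (x + s) by field.
      replace (y + t/2 + t/2) with (y + t) by field. ring.
  - intros u v eps Hu Hv Heps.
    destruct (HG u v Hu Hv) as [l Hl].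
    destruct (proj1 (is_Cderive_eps _ _ _) Hl (eps / 2) ltac:(lra)) as [d [Hd HD]].
    exists (d / 2); split; [lra|]. intros x y s t Hs Ht Hx1 Hx2 Hy1 Hy2 Hux Hvy.
    assert (HE : forall p q, x <= p <= x + s -> y <= q <= y + t ->
      Cmod (G (p, q) - G (u, v) - l * ((p, q) - (u, v))) <= eps / 2 * (s + t)).
    { intros p q Hp Hq.
      assert (Hc : Cmod ((p, q) - (u, v)) <= s + t).
      { eapply Rle_trans; [apply Cmod_le_Re_Im|]. simpl.
        apply Rplus_le_compat; apply Rabs_le; lra. }
      eapply Rle_trans; [apply HD; lra|]. apply Rmult_le_compat_l; lra. }
    assert (E1 : Cmod (V (x + s)%R y t - V x y t - RtoC t * (l * RtoC s)) <= t * (eps * (s + t))).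
    { assert (E := CRInt_near_const (fun q => G ((x + s)%R, q) - G (x, q))%C y (y + t)
        (eps * (s + t)) (l * RtoC s) (V (x + s)%R y t - V x y t)%C).
      replace (y + t - y) with t in E by ring. apply E; [lra| |].
      - apply (is_RInt_minus (V := C_R_NormedModule)); apply HV; lra.
      - intros q Hq.
        replace (G ((x + s)%R, q) - G (x, q) - l * RtoC s)%C with
          ((G ((x + s)%R, q) - G (u, v) - l * (((x + s)%R, q) - (u, v)))
            - (G (x, q) - G (u, v) - l * ((x, q) - (u, v))))%C.
        + eapply Rle_trans; [apply Cmod_minus_le|].
          generalize (HE (x + s) q ltac:(lra) ltac:(lra)) (HE x q ltac:(lra) ltac:(lra)). lra.
        + replace (RtoC s) with (((x + s)%R, q) - (x, q))%C; [ring|].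
          unfold RtoC, Cminus, Cplus, Copp; simpl; f_equal; ring. }
    assert (E2 : Cmod (H (y + t)%R x s - H y x s - RtoC s * (l * (Ci * RtoC t)))
                 <= s * (eps * (s + t))).
    { assert (E := CRInt_near_const (fun q => G (q, (y + t)%R) - G (q, y))%C x (x + s)
        (eps * (s + t)) (l * (Ci * RtoC t)) (H (y + t)%R x s - H y x s)%C).
      replace (x + s - x) with s in E by ring. apply E; [lra| |].
      - apply (is_RInt_minus (V := C_R_NormedModule)); apply HH; lra.
      - intros q Hq.
        replace (G (q, (y + t)%R) - G (q, y) - l * (Ci * RtoC t))%C with
          ((G (q, (y + t)%R) - G (u, v) - l * ((q, (y + t)%R) - (u, v)))
            - (G (q, y) - G (u, v) - l * ((q, y) - (u, v))))%C.
        + eapply Rle_trans; [apply Cmod_minus_le|].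
          generalize (HE q (y + t) ltac:(lra) ltac:(lra)) (HE q y ltac:(lra) ltac:(lra)). lra.
        + replace (Ci * RtoC t)%C with ((q, (y + t)%R) - (q, y))%C; [ring|].
          unfold RtoC, Ci, Cminus, Cplus, Cmult, Copp; simpl; f_equal; ring. }
    unfold B.
    replace (Ci * (V (x + s)%R y t - V x y t) - (H (y + t)%R x s - H y x s))%C with
      (Ci * (V (x + s)%R y t - V x y t - RtoC t * (l * RtoC s))
       - (H (y + t)%R x s - H y x s - RtoC s * (l * (Ci * RtoC t))))%C by ring.
    eapply Rle_trans; [apply Cmod_minus_le|].
    rewrite Cmod_mult, Cmod_Ci, Rmult_1_l. nra. }
apply Ceq_minus. apply Cmod_eq_0, Rle_antisym; [exact HB | apply Cmod_ge_0].
Qed.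
(** * Circle means and the mean value property *)

Definition cis (t : R) : C := (cos t, sin t).

Definition circle (a : C) (r t : R) : C := (a + RtoC r * cis t)%C.

Definition Cexp (z : C) : C := (RtoC (exp (Re z)) * cis (Im z))%C.

Lemma Cmod_cis (t : R) : Cmod (cis t) = 1.
Proof.
transitivity (sqrt 1); [|apply sqrt_1]. unfold Cmod, cis; simpl; f_equal.
generalize (sin2_cos2 t); unfold Rsqr; lra.
Qed.

Lemma cis_conj_l (t : R) : (Cconj (cis t) * cis t)%C = RtoC 1.
Proof.
unfold Cconj, cis, Cmult, RtoC; simpl.
generalize (sin2_cos2 t); unfold Rsqr; intros H; f_equal; lra.
Qed.

Lemma Cmod_conj (z : C) : Cmod (Cconj z) = Cmod z.
Proof. unfold Cmod, Cconj; simpl. f_equal; ring. Qed.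

Lemma Cmod_circle (a : C) (r t : R) : 0 <= r -> Cmod (circle a r t - a) = r.
Proof.
intros Hr. unfold circle. replace (a + RtoC r * cis t - a)%C with (RtoC r * cis t)%C by ring.
rewrite Cmod_mult, Cmod_cis, Cmod_R, Rabs_pos_eq by auto. ring.
Qed.

Lemma cis_continuous (t : R) : Rcurve_continuous cis t.
Proof.
apply Rcurve_continuous_iff; split; simpl; [apply continuous_cos | apply continuous_sin].
Qed.

Lemma Rcurve_continuous_plus (u v : R -> C) (t : R) :
  Rcurve_continuous u t -> Rcurve_continuous v t ->
  Rcurve_continuous (fun s => u s + v s)%C t.
Proof. exact (continuous_plus (V := C_R_NormedModule) u v t). Qed.

Lemma Rcurve_continuous_mult (u v : R -> C) (t : R) :
  Rcurve_continuous u t -> Rcurve_continuous v t ->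
  Rcurve_continuous (fun s => u s * v s)%C t.
Proof.
rewrite !Rcurve_continuous_iff. intros [H1 H2] [H3 H4]; split.
- apply (continuous_minus (fun s => Re (u s) * Re (v s)) (fun s => Im (u s) * Im (v s)));
    now apply (continuous_mult (K := R_AbsRing)).
- apply (continuous_plus (fun s => Re (u s) * Im (v s)) (fun s => Im (u s) * Re (v s)));
    now apply (continuous_mult (K := R_AbsRing)).
Qed.

Lemma Rcurve_continuous_const (c : C) (t : R) : Rcurve_continuous (fun _ => c) t.
Proof. exact (continuous_const c t). Qed.

Lemma Rcurve_continuous_conj (u : R -> C) (t : R) :
  Rcurve_continuous u t -> Rcurve_continuous (fun s => Cconj (u s)) t.
Proof.
rewrite !Rcurve_continuous_iff. intros [H1 H2]; split; [exact H1|].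
exact (continuous_opp (fun s => Im (u s)) t H2).
Qed.

Lemma circle_continuous (a : C) (r t : R) : Rcurve_continuous (circle a r) t.
Proof.
apply Rcurve_continuous_plus; [apply Rcurve_continuous_const|].
apply Rcurve_continuous_mult; [apply Rcurve_continuous_const | apply cis_continuous].
Qed.

(** [m] is the mean of [u] over a period, stated relationally so that existence and value
    come together. *)
Definition is_cmean (u : R -> C) (m : C) : Prop := is_CRInt u 0 (2 * PI) (RtoC (2 * PI) * m)%C.

Lemma two_PI_pos : 0 < 2 * PI.
Proof. generalize PI_RGT_0; lra. Qed.

Lemma is_cmean_eq (u : R -> C) (m n : C) : is_cmean u m -> m = n -> is_cmean u n.
Proof. now intros H <-. Qed.

Lemma is_cmean_ext (u v : R -> C) (m : C) :
  (forall t, u t = v t) -> is_cmean u m -> is_cmean v m.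
Proof. intros H. apply is_RInt_ext. intros; apply H. Qed.

Lemma ex_cmean (u : R -> C) : (forall t, Rcurve_continuous u t) -> exists m, is_cmean u m.
Proof.
intros Hu. exists (CRInt u 0 (2 * PI) / RtoC (2 * PI))%C. unfold is_cmean.
assert (Hp : RtoC (2 * PI) <> 0%C).
{ intros H; apply RtoC_inj in H; generalize two_PI_pos; lra. }
assert (Hx : forall l : C, (RtoC (2 * PI) * (l / RtoC (2 * PI)))%C = l) by (intros; field; auto).
rewrite Hx.
apply is_CRInt_continuous; [apply Rlt_le, two_PI_pos | auto].
Qed.

Lemma is_cmean_const (c : C) : is_cmean (fun _ => c) c.
Proof.
unfold is_cmean. rewrite <- scal_R_Cmult.
replace (2 * PI) with (2 * PI - 0) at 2 by ring.
apply (is_RInt_const (V := C_R_NormedModule)).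
Qed.

Lemma is_cmean_minus (u v : R -> C) (m n : C) :
  is_cmean u m -> is_cmean v n -> is_cmean (fun t => u t - v t)%C (m - n)%C.
Proof.
unfold is_cmean; intros H1 H2.
replace (RtoC (2 * PI) * (m - n))%C with (RtoC (2 * PI) * m - RtoC (2 * PI) * n)%C by ring.
now apply (is_RInt_minus (V := C_R_NormedModule)).
Qed.

Lemma is_cmean_scal (u : R -> C) (c m : C) :
  is_cmean u m -> is_cmean (fun t => c * u t)%C (c * m)%C.
Proof.
unfold is_cmean; intros H.
replace (RtoC (2 * PI) * (c * m))%C with (c * (RtoC (2 * PI) * m))%C by ring.
set (l := (RtoC (2 * PI) * m)%C) in *.
assert (H1 := is_RInt_fct_extend_fst u 0 (2 * PI) l H).
assert (H2 := is_RInt_fct_extend_snd u 0 (2 * PI) l H).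
apply (is_RInt_fct_extend_pair (fun t => c * u t)%C).
- apply (is_RInt_minus (fun t => fst c * fst (u t)) (fun t => snd c * snd (u t)));
  now apply (is_RInt_scal (V := R_NormedModule)).
- apply (is_RInt_plus (fun t => fst c * snd (u t)) (fun t => snd c * fst (u t)));
  now apply (is_RInt_scal (V := R_NormedModule)).
Qed.

Lemma is_cmean_conj (u : R -> C) (m : C) :
  is_cmean u m -> is_cmean (fun t => Cconj (u t)) (Cconj m).
Proof.
unfold is_cmean; intros H.
replace (RtoC (2 * PI) * Cconj m)%C with (Cconj (RtoC (2 * PI) * m))%C
  by (unfold Cconj, Cmult, RtoC; simpl; f_equal; ring).
set (l := (RtoC (2 * PI) * m)%C) in *.
assert (H1 := is_RInt_fct_extend_fst u 0 (2 * PI) l H).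
assert (H2 := is_RInt_fct_extend_snd u 0 (2 * PI) l H).
apply (is_RInt_fct_extend_pair (fun t => Cconj (u t))); [exact H1|].
exact (is_RInt_opp (fun t => snd (u t)) 0 (2 * PI) _ H2).
Qed.

(** Comparison with the real part of a second mean, instead of with a constant, is what
    lets positivity of the real part replace boundedness. *)
Lemma is_cmean_bound (u v : R -> C) (m n : C) (k : R) :
  (forall t, 0 <= t <= 2 * PI -> Cmod (u t) <= k * Re (v t)) -> is_cmean u m -> is_cmean v n ->
  Cmod m <= k * Re n.
Proof.
intros Hb Hu Hv.
assert (Hp := two_PI_pos).
assert (H1 := is_RInt_fct_extend_fst v 0 (2 * PI) _ Hv).
apply Rmult_le_reg_l with (2 * PI); [exact Hp|].
replace (2 * PI * Cmod m) with (Cmod (RtoC (2 * PI) * m))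
  by (rewrite Cmod_mult, Cmod_R, Rabs_pos_eq; lra).
rewrite <- norm_C_R.
apply (norm_RInt_le (V := C_R_NormedModule) u (fun t => k * Re (v t)) 0 (2 * PI)).
- lra.
- intros t Ht. rewrite norm_C_R. now apply Hb.
- exact Hu.
- replace (2 * PI * (k * Re n)) with (k * fst (RtoC (2 * PI) * n)%C)
    by (unfold Cmult, RtoC, Re; simpl; ring).
  now apply (is_RInt_scal (V := R_NormedModule) (fun t => fst (v t))).
Qed.

Lemma is_cmean_le (u : R -> C) (m : C) (M : R) :
  (forall t, 0 <= t <= 2 * PI -> Cmod (u t) <= M) -> is_cmean u m -> Cmod m <= M.
Proof.
intros Hb Hu. rewrite <- (Rmult_1_l M).
apply (is_cmean_bound u (fun _ => RtoC M) m (RtoC M)); auto.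
- intros t Ht; simpl. rewrite Rmult_1_l; now apply Hb.
- apply is_cmean_const.
Qed.

Lemma derivable_pt_lim_eps (f : R -> R) (x l : R) : derivable_pt_lim f x l ->
  forall eps, 0 < eps -> exists d, 0 < d /\
    forall h, Rabs h < d -> Rabs (f (x + h) - f x - l * h) <= eps * Rabs h.
Proof.
intros H eps Heps. destruct (H eps Heps) as [d Hd].
exists d; split; [apply cond_pos|]. intros h Hh.
destruct (Req_dec h 0) as [->|Hn].
- rewrite Rplus_0_r, Rmult_0_r, !Rminus_0_r, Rminus_diag, Rabs_R0; lra.
- replace (f (x + h) - f x - l * h) with (((f (x + h) - f x) / h - l) * h) by (field; auto).
  rewrite Rabs_mult. apply Rmult_le_compat_r; [apply Rabs_pos|]. now apply Rlt_le, Hd.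
Qed.

Lemma Cexp_plus (z w : C) : Cexp (z + w) = (Cexp z * Cexp w)%C.
Proof.
destruct z as [a b], w as [c d].
unfold Cexp, cis, Cmult, Cplus, RtoC, Re, Im; simpl.
rewrite exp_plus, cos_plus, sin_plus. f_equal; ring.
Qed.

(** Both components reduce to the first-order expansions of the real [exp], [cos] and [sin]
    at 0. *)
Lemma is_Cderive_exp_0 : is_Cderive Cexp (RtoC 0) (RtoC 1).
Proof.
apply is_Cderive_eps; intros eps Heps.
(* The two components add up to at most six errors of size [e * Cmod w]. *)
assert (He : 0 < Rmin (eps / 6) 1) by (apply Rmin_pos; lra).
set (e := Rmin (eps / 6) 1) in *.
assert (He1 : e <= eps / 6) by apply Rmin_l. assert (He2 : e <= 1) by apply Rmin_r.
destruct (derivable_pt_lim_eps exp 0 1 derivable_pt_lim_exp_0 e He) as [d1 [Hd1 H1]].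
assert (Hs := derivable_pt_lim_sin 0). rewrite cos_0 in Hs.
assert (Hc := derivable_pt_lim_cos 0). rewrite sin_0, Ropp_0 in Hc.
destruct (derivable_pt_lim_eps _ _ _ Hs e He) as [d2 [Hd2 H2]].
destruct (derivable_pt_lim_eps _ _ _ Hc e He) as [d3 [Hd3 H3]].
exists (Rmin (Rmin d1 d2) (Rmin d3 (e / 2))); split.
{ repeat apply Rmin_pos; lra. }
intros w Hw.
assert (Hm1 := Rmin_l (Rmin d1 d2) (Rmin d3 (e / 2))).
assert (Hm2 := Rmin_r (Rmin d1 d2) (Rmin d3 (e / 2))).
assert (Hm3 := Rmin_l d1 d2). assert (Hm4 := Rmin_r d1 d2).
assert (Hm5 := Rmin_l d3 (e / 2)). assert (Hm6 := Rmin_r d3 (e / 2)).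
replace (w - RtoC 0)%C with w in * by ring.
assert (HR := Re_le_Cmod w). assert (HI := Im_le_Cmod w).
destruct w as [x y]; simpl in HR, HI.
specialize (H1 x ltac:(lra)). specialize (H2 y ltac:(lra)). specialize (H3 y ltac:(lra)).
rewrite Rplus_0_l in H1, H2, H3. rewrite exp_0 in H1. rewrite sin_0 in H2. rewrite cos_0 in H3.
set (m := Cmod (x, y)) in *.
assert (Hx := Rabs_pos x). assert (Hy := Rabs_pos y).
assert (K1 : Rabs (exp x - 1) <= e).
{ replace (exp x - 1) with ((exp x - 1 - 1 * x) + x) by ring.
  eapply Rle_trans; [apply Rabs_triang|]. nra. }
assert (K2 : exp x <= 2) by (apply Rabs_le_between in K1; lra).
assert (K3 : 0 < exp x) by apply exp_pos.
assert (Hm : Rabs x + Rabs y <= 2 * m) by lra.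
eapply Rle_trans; [apply Cmod_le_Re_Im|].
replace (Re (Cexp (x, y) - Cexp (RtoC 0) - RtoC 1 * (x, y))%C)
  with ((exp x - 1 - 1 * x) + exp x * (cos y - 1 - 0 * y)).
2:{ unfold Cexp, cis, Cmult, Cminus, Cplus, Copp, RtoC, Re, Im; simpl.
    rewrite exp_0, cos_0, sin_0. ring. }
replace (Im (Cexp (x, y) - Cexp (RtoC 0) - RtoC 1 * (x, y))%C)
  with (exp x * (sin y - 0 - 1 * y) + (exp x - 1) * y).
2:{ unfold Cexp, cis, Cmult, Cminus, Cplus, Copp, RtoC, Re, Im; simpl.
    rewrite exp_0, cos_0, sin_0. ring. }
assert (L1 : Rabs ((exp x - 1 - 1 * x) + exp x * (cos y - 1 - 0 * y)) <= e * Rabs x + 2 * (e * Rabs y)).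
{ eapply Rle_trans; [apply Rabs_triang|]. apply Rplus_le_compat; [exact H1|].
  rewrite Rabs_mult. apply Rmult_le_compat; try apply Rabs_pos; [|exact H3].
  rewrite Rabs_pos_eq; lra. }
assert (L2 : Rabs (exp x * (sin y - 0 - 1 * y) + (exp x - 1) * y) <= 2 * (e * Rabs y) + e * Rabs y).
{ eapply Rle_trans; [apply Rabs_triang|]. rewrite !Rabs_mult. apply Rplus_le_compat.
  - apply Rmult_le_compat; try apply Rabs_pos; [|exact H2]. rewrite Rabs_pos_eq; lra.
  - apply Rmult_le_compat_r; [exact Hy | exact K1]. }
assert (e * Rabs x <= e * m) by (apply Rmult_le_compat_l; lra).
assert (e * Rabs y <= e * m) by (apply Rmult_le_compat_l; lra).
assert (e * m <= eps / 6 * m) by (apply Rmult_le_compat_r; lra).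
lra.
Qed.

Lemma is_Cderive_exp (z : C) : is_Cderive Cexp z (Cexp z).
Proof.
apply (is_Cderive_ext_ball (fun w => Cexp z * Cexp (w - z))%C _ z _ 1 Rlt_0_1).
{ intros w _. rewrite <- Cexp_plus. f_equal; ring. }
eapply is_Cderive_eq.
- apply (is_Cderive_mult (fun _ => Cexp z) (fun w => Cexp (w - z))).
  + apply is_Cderive_const.
  + apply (is_Cderive_comp Cexp (fun w => w - z)%C).
    * replace (z - z)%C with (RtoC 0) by ring. apply is_Cderive_exp_0.
    * apply is_Cderive_minus; [apply is_Cderive_id | apply is_Cderive_const].
- ring.
Qed.

(** In the coordinate [a + exp z] the annulus becomes a rectangle.  By periodicity its
    horizontal sides cancel, so Goursat's theorem equates the integrals along the vertical
    sides, which are the two circle integrals. *)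
Lemma circle_mean_indep (f : C -> C) (a : C) (rho r1 r2 : R) :
  0 < r1 < r2 -> r2 < rho ->
  (forall z : C, 0 < Cmod (z - a) < rho -> exists l, is_Cderive f z l) ->
  CRInt (fun t => f (circle a r1 t)) 0 (2 * PI) = CRInt (fun t => f (circle a r2 t)) 0 (2 * PI).
Proof.
intros [Hr1 Hr] Hr2 Hf.
set (G := fun z => f (a + Cexp z)%C).
assert (HP := two_PI_pos).
assert (Hl : ln r1 < ln r2) by (apply ln_increasing; lra).
assert (HG := goursat G (ln r1) 0 (ln r2 - ln r1) (2 * PI) ltac:(lra) HP).
replace (ln r1 + (ln r2 - ln r1)) with (ln r2) in HG by ring.
rewrite Rplus_0_l in HG.
assert (Hcirc : forall r t, 0 < r -> G (ln r, t) = f (circle a r t)).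
{ intros r t H. unfold G, circle, Cexp; simpl. now rewrite exp_ln. }
assert (E : (Ci * (CRInt (fun y => G (ln r2, y)) 0 (2 * PI)
     - CRInt (fun y => G (ln r1, y)) 0 (2 * PI)))%C = RtoC 0).
{ rewrite HG.
  - apply (proj1 (Ceq_minus _ _)). apply (RInt_ext (V := C_R_CompleteNormedModule)).
    intros x _. unfold G, Cexp, cis; simpl.
    now rewrite cos_2PI, sin_2PI, cos_0, sin_0.
  - intros u v Hu _. set (z := (u, v) : C).
    assert (Hm : Cmod (a + Cexp z - a) = exp u).
    { replace (a + Cexp z - a)%C with (Cexp z) by ring.
      unfold Cexp; rewrite Cmod_mult, Cmod_cis, Cmod_R, Rabs_pos_eq; simpl.
      - ring. - apply Rlt_le, exp_pos. }
    destruct (Hf (a + Cexp z)%C) as [l Hl'].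
    { rewrite Hm. split; [apply exp_pos|]. apply Rle_lt_trans with r2; [|exact Hr2].
      rewrite <- (exp_ln r2) by lra.
      destruct (Req_dec u (ln r2)) as [->|Hn]; [lra|]. left; apply exp_increasing; lra. }
    exists (l * (RtoC 0 + Cexp z))%C.
    apply (is_Cderive_comp f (fun z => a + Cexp z)%C); [exact Hl'|].
    apply is_Cderive_plus; [apply is_Cderive_const | apply is_Cderive_exp]. }
rewrite (RInt_ext (V := C_R_CompleteNormedModule) _ (fun t => G (ln r1, t)))
  by (intros; symmetry; apply Hcirc; lra).
rewrite (RInt_ext (V := C_R_CompleteNormedModule) (fun t => f (circle a r2 t)) (fun t => G (ln r2, t)))
  by (intros; symmetry; apply Hcirc; lra).
symmetry; apply (proj2 (Ceq_minus _ _)).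
revert E; generalize (CRInt (fun y => G (ln r2, y)) 0 (2 * PI) - CRInt (fun y => G (ln r1, y)) 0 (2 * PI))%C.
intros D E.
replace D with (- Ci * (Ci * D))%C.
- change (- Ci * (Ci * D) = RtoC 0)%C. rewrite E; ring.
- transitivity (- (Ci * Ci) * D)%C; [ring|].
  replace (- (Ci * Ci))%C with (RtoC 1)
    by (unfold Ci, Copp, Cmult, RtoC; simpl; f_equal; ring). ring.
Qed.

(** The circle mean does not depend on the radius and tends to [f a] as the radius tends
    to 0.  The centre may be a point of mere continuity, as it is for
    difference quotients. *)
Lemma mean_value (f : C -> C) (a : C) (rho r : R) :
  0 < r < rho -> Ccontinuous f a ->
  (forall z : C, 0 < Cmod (z - a) < rho -> exists l, is_Cderive f z l) ->
  is_cmean (fun t => f (circle a r t)) (f a).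
Proof.
intros Hr Hc Hf.
assert (Hcont : forall s t, 0 < s < rho -> Rcurve_continuous (fun t => f (circle a s t)) t).
{ intros s t Hs. apply (Rcurve_continuous_comp f (circle a s)); [apply circle_continuous|].
  destruct (Hf (circle a s t)) as [l Hl].
  - rewrite Cmod_circle; lra.
  - now apply is_Cderive_continuous with l. }
destruct (ex_cmean (fun t => f (circle a r t))) as [m Hm].
{ intros t; now apply Hcont. }
apply is_cmean_eq with m; [exact Hm|].
apply (proj2 (Ceq_minus _ _)), Cmod_eq_0, Rle_antisym; [|apply Cmod_ge_0].
apply Rnot_lt_le; intros Hpos.
destruct (proj1 (Ccontinuous_eps _ _) Hc (Cmod (m - f a) / 2) ltac:(lra)) as [d [Hd HD]].
set (s := Rmin (d / 2) (r / 2)).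
assert (Hs : 0 < s) by (apply Rmin_pos; lra).
assert (Hs1 : s <= d / 2) by apply Rmin_l. assert (Hs2 : s <= r / 2) by apply Rmin_r.
assert (Hms : is_cmean (fun t => f (circle a s t)) m).
{ unfold is_cmean in *.
  apply (is_RInt_unique (V := C_R_CompleteNormedModule)) in Hm.
  rewrite <- Hm, <- (circle_mean_indep f a rho s r ltac:(lra) ltac:(lra) Hf).
  apply is_CRInt_continuous; [apply Rlt_le, two_PI_pos|].
  intros t _. apply Hcont; lra. }
assert (HH : Cmod (m - f a) <= Cmod (m - f a) / 2).
{ apply (is_cmean_le (fun t => f (circle a s t) - f a)%C).
  - intros t _. apply Rlt_le, HD. rewrite Cmod_circle; lra.
  - apply is_cmean_minus; [exact Hms | apply is_cmean_const]. }
lra.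
Qed.
(** * Cauchy formula for the derivative and its holomorphy *)

Lemma derivable_pt_lim_of_eps (f : R -> R) (x l : R) :
  (forall eps, 0 < eps -> exists d, 0 < d /\
    forall h, Rabs h < d -> Rabs (f (x + h) - f x - l * h) <= eps * Rabs h) ->
  derivable_pt_lim f x l.
Proof.
intros H eps Heps. destruct (H (eps / 2) ltac:(lra)) as [d [Hd HD]].
exists (mkposreal d Hd). intros h Hh Hhd; simpl in Hhd.
replace ((f (x + h) - f x) / h - l) with ((f (x + h) - f x - l * h) / h) by (field; auto).
unfold Rdiv; rewrite Rabs_mult, Rabs_inv.
assert (0 < Rabs h) by now apply Rabs_pos_lt.
apply Rle_lt_trans with (eps / 2); [|lra].
apply Rle_div_l; [assumption|]. now apply HD.
Qed.

(** With [c] a unimodular constant this gives the derivative of any real component of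
    [f] along a line; [c = 1] and [c = - Ci] yield the real and imaginary parts. *)
Lemma is_derive_Re_line (f : C -> C) (a v c l : C) (t : R) :
  is_Cderive f (a + RtoC t * v)%C l ->
  is_derive (fun s : R => Re (c * f (a + RtoC s * v))%C) t (Re (c * l * v)%C).
Proof.
intros H. apply is_derive_Reals, derivable_pt_lim_of_eps. intros eps Heps.
assert (Hc := Cmod_ge_0 c). assert (Hv := Cmod_ge_0 v).
assert (HK : 0 < (Cmod c + 1) * (Cmod v + 1)) by (apply Rmult_lt_0_compat; lra).
set (K := (Cmod c + 1) * (Cmod v + 1)) in *.
destruct (proj1 (is_Cderive_eps _ _ _) H (eps / K)) as [d [Hd HD]].
{ now apply Rdiv_lt_0_compat. }
exists (d / (Cmod v + 1)); split; [apply Rdiv_lt_0_compat; lra|].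
intros h Hh.
replace (Re (c * f (a + RtoC (t + h) * v))%C - Re (c * f (a + RtoC t * v))%C - Re (c * l * v)%C * h)
  with (Re (c * (f (a + RtoC (t + h) * v) - f (a + RtoC t * v)
    - l * ((a + RtoC (t + h) * v) - (a + RtoC t * v))))%C).
2:{ rewrite RtoC_plus.
    replace ((a + (RtoC t + RtoC h) * v) - (a + RtoC t * v))%C with (RtoC h * v)%C by ring.
    unfold Re, Cmult, Cminus, Cplus, Copp, RtoC; simpl; ring. }
eapply Rle_trans; [apply Re_le_Cmod|]. rewrite Cmod_mult.
assert (Hd2 : Cmod ((a + RtoC (t + h) * v) - (a + RtoC t * v)) = Rabs h * Cmod v).
{ rewrite RtoC_plus.
  replace ((a + (RtoC t + RtoC h) * v) - (a + RtoC t * v))%C with (RtoC h * v)%C by ring.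
  now rewrite Cmod_mult, Cmod_R. }
assert (Hh' : Rabs h * (Cmod v + 1) < d).
{ apply Rlt_div_r in Hh; [exact Hh | lra]. }
assert (Hah := Rabs_pos h).
specialize (HD (a + RtoC (t + h) * v)%C). rewrite Hd2 in HD.
specialize (HD ltac:(nra)).
apply Rle_trans with ((Cmod c + 1) * (eps / K * (Rabs h * (Cmod v + 1)))).
- apply Rmult_le_compat; try apply Cmod_ge_0; [lra|].
  eapply Rle_trans; [apply HD|]. apply Rmult_le_compat_l; [|nra].
  apply Rlt_le, Rdiv_lt_0_compat; lra.
- right. unfold K; field; lra.
Qed.

(** The real mean value theorem applies to the component of [f] in the direction of
    [f b - f a]. *)
Lemma segment_bound (f : C -> C) (a b : C) (M : R) :
  (forall t, 0 <= t <= 1 -> exists l, is_Cderive f (a + RtoC t * (b - a))%C l /\ Cmod l <= M) ->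
  Cmod (f b - f a) <= M * Cmod (b - a).
Proof.
intros H.
set (c := Cconj (f b - f a)).
destruct (MVT_gen (fun s => Re (c * f (a + RtoC s * (b - a)))%C) 0 1
  (fun t => Re (c * C_derive f (a + RtoC t * (b - a)) * (b - a))%C)) as [t [Ht E]].
- intros t Ht. rewrite Rmin_left, Rmax_right in Ht by lra.
  apply is_derive_Re_line. destruct (H t ltac:(lra)) as [l [Hl _]].
  apply C_derive_is. now exists l.
- intros t Ht. rewrite Rmin_left, Rmax_right in Ht by lra.
  destruct (H t ltac:(lra)) as [l [Hl _]].
  apply continuity_pt_filterlim.
  apply (ex_derive_continuous (K := R_AbsRing) (V := R_NormedModule)).
  exists (Re (c * l * (b - a))%C). now apply is_derive_Re_line.
- rewrite Rmin_left, Rmax_right in Ht by lra.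
  destruct (H t Ht) as [l [Hl HM]].
  rewrite (is_C_derive_unique _ _ _ Hl) in E.
  replace (a + RtoC 1 * (b - a))%C with b in E by ring.
  replace (a + RtoC 0 * (b - a))%C with a in E by ring.
  set (D := Cmod (f b - f a)).
  assert (E1 : Re (c * f b)%C - Re (c * f a)%C = D ^ 2).
  { unfold D; rewrite Cmod_sqr. unfold c, Re, Im, Cconj, Cmult, Cminus, Cplus, Copp; simpl; ring. }
  assert (E2 : D ^ 2 <= D * (M * Cmod (b - a))).
  { rewrite <- E1, E, Rminus_0_r, Rmult_1_r.
    eapply Rle_trans; [apply Rle_abs|]. eapply Rle_trans; [apply Re_le_Cmod|].
    rewrite !Cmod_mult. unfold c; rewrite Cmod_conj; fold D.
    rewrite Rmult_assoc. apply Rmult_le_compat_l; [apply Cmod_ge_0|].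
    apply Rmult_le_compat_r; [apply Cmod_ge_0 | exact HM]. }
  assert (HD : 0 <= D) by apply Cmod_ge_0.
  destruct (Req_dec D 0) as [->|Hn].
  + apply Rmult_le_pos; [|apply Cmod_ge_0].
    eapply Rle_trans; [apply Cmod_ge_0 | exact HM].
  + apply Rmult_le_reg_l with D; [lra|]. simpl in E2; lra.
Qed.

Definition holo_ball (a : C) (rho : R) (f : C -> C) : Prop :=
  forall z : C, Cmod (z - a) < rho -> ex_Cderive f z.

Lemma holo_ball_sub (f : C -> C) (a b : C) (rho r : R) :
  Cmod (b - a) + r <= rho -> holo_ball a rho f -> holo_ball b r f.
Proof.
intros Hr H z Hz. apply H.
replace (z - a)%C with ((z - b) + (b - a))%C by ring.
eapply Rle_lt_trans; [apply Cmod_triangle|]. lra.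
Qed.

Lemma holo_ball_continuous (f : C -> C) (a z : C) (rho : R) :
  holo_ball a rho f -> Cmod (z - a) < rho -> Ccontinuous f z.
Proof. intros H Hz. destruct (H z Hz) as [l Hl]. now apply is_Cderive_continuous with l. Qed.

Lemma circle_comp_continuous (f : C -> C) (a : C) (rho r t : R) :
  0 < r < rho -> holo_ball a rho f -> Rcurve_continuous (fun s => f (circle a r s)) t.
Proof.
intros Hr H. apply (Rcurve_continuous_comp f (circle a r)); [apply circle_continuous|].
apply (holo_ball_continuous _ _ _ _ H). rewrite Cmod_circle; lra.
Qed.

Lemma mean_value_holo (f : C -> C) (a : C) (rho r : R) :
  0 < r < rho -> holo_ball a rho f -> is_cmean (fun t => f (circle a r t)) (f a).
Proof.
intros Hr H. apply (mean_value f a rho r Hr).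
- apply (holo_ball_continuous _ _ _ _ H). replace (a - a)%C with (RtoC 0) by ring.
  rewrite Cmod_0; lra.
- intros z Hz. apply H; lra.
Qed.

Lemma is_cmean_cis_conj : is_cmean (fun t => Cconj (cis t)) (RtoC 0).
Proof.
apply is_cmean_eq with (Cconj (RtoC 0)).
2:{ unfold Cconj, RtoC; simpl; f_equal; ring. }
apply is_cmean_conj.
apply is_cmean_ext with (fun t => circle (RtoC 0) 1 t).
{ intros t; unfold circle; ring. }
apply (mean_value_holo (fun z => z) (RtoC 0) 2 1); [lra|].
intros z _. exists (RtoC 1). apply is_Cderive_id.
Qed.

Lemma difference_quotient_continuous (f : C -> C) (w l : C) :
  is_Cderive f w l ->
  Ccontinuous (fun z => if Ceq_dec z w then l else (f z - f w) / (z - w))%C w.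
Proof.
intros Hl. apply Ccontinuous_eps; intros eps Heps.
destruct (proj1 (is_Cderive_eps _ _ _) Hl (eps / 2) ltac:(lra)) as [d [Hd HD]].
exists d; split; [exact Hd|]. intros z Hz.
destruct (Ceq_dec w w) as [_|N]; [|now elim N].
destruct (Ceq_dec z w) as [->|N].
- replace (l - l)%C with (RtoC 0) by ring. now rewrite Cmod_0.
- assert (Hn : (z - w)%C <> 0%C) by now apply Cminus_eq_contra.
  replace ((f z - f w) / (z - w) - l)%C with ((f z - f w - l * (z - w)) / (z - w))%C
    by (field; auto).
  rewrite Cmod_div by auto.
  apply Rle_lt_trans with (eps / 2); [|lra].
  apply Rle_div_l; [now apply Cmod_gt_0|]. now apply HD.
Qed.

Lemma difference_quotient_derive (f : C -> C) (w l z : C) :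
  z <> w -> ex_Cderive f z ->
  exists m, is_Cderive (fun z => if Ceq_dec z w then l else (f z - f w) / (z - w))%C z m.
Proof.
intros Hz [m Hm].
assert (Hn : (z - w)%C <> 0%C) by now apply Cminus_eq_contra.
eexists. apply (is_Cderive_ext_ball (fun z => (f z - f w) / (z - w))%C _ z _ (Cmod (z - w))).
- now apply Cmod_gt_0.
- intros y Hy. destruct (Ceq_dec y w) as [->|_]; [|reflexivity].
  rewrite Cmod_minus_sym in Hy; lra.
- apply (is_Cderive_div (fun z => f z - f w)%C (fun z => z - w)%C); [exact Hn| |].
  + apply is_Cderive_minus; [exact Hm | apply is_Cderive_const].
  + apply is_Cderive_minus; [apply is_Cderive_id | apply is_Cderive_const].
Qed.

(** Mean value property of the difference quotient at [w]: on the circle, division by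
    [z - w] is multiplication by [conj (cis t) / r], and the constant [f w] contributes
    nothing since [conj (cis t)] has mean 0. *)
Lemma cauchy_derivative (f : C -> C) (w l : C) (rho r : R) :
  0 < r < rho -> holo_ball w rho f -> is_Cderive f w l ->
  is_cmean (fun t => f (circle w r t) * Cconj (cis t))%C (RtoC r * l)%C.
Proof.
intros Hr Hf Hl.
set (Q := fun z => if Ceq_dec z w then l else ((f z - f w) / (z - w))%C).
assert (HQ : is_cmean (fun t => Q (circle w r t)) l).
{ replace l with (Q w) at 1 by (unfold Q; destruct (Ceq_dec w w) as [_|N]; [reflexivity | now elim N]).
  apply (mean_value Q w rho r Hr).
  - now apply difference_quotient_continuous.
  - intros z [Hz1 Hz2]. apply difference_quotient_derive; [|now apply Hf].
    intros ->. replace (w - w)%C with (RtoC 0) in Hz1 by ring. rewrite Cmod_0 in Hz1; lra. }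
apply (is_cmean_scal _ (RtoC r)) in HQ.
assert (H2 := is_cmean_scal _ (- f w)%C _ is_cmean_cis_conj).
assert (H3 := is_cmean_minus _ _ _ _ HQ H2).
apply is_cmean_eq with (RtoC r * l - - f w * RtoC 0)%C; [|ring].
apply is_cmean_ext with (2 := H3).
intros t. unfold Q.
assert (Hn : (circle w r t - w)%C <> 0%C) by (apply Cmod_gt_0; rewrite Cmod_circle; lra).
destruct (Ceq_dec (circle w r t) w) as [E|_].
{ elim Hn. rewrite E; ring. }
assert (E : (RtoC r = (circle w r t - w) * Cconj (cis t))%C).
{ transitivity (RtoC r * (Cconj (cis t) * cis t))%C.
  - rewrite cis_conj_l; ring.
  - unfold circle; ring. }
rewrite E at 1. field. exact Hn.
Qed.

(** Mean value property of [(z - w) f z], which vanishes at [w]. *)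
Lemma cauchy_vanishing (f : C -> C) (w : C) (rho r : R) :
  0 < r < rho -> holo_ball w rho f ->
  is_cmean (fun t => f (circle w r t) * cis t)%C (RtoC 0).
Proof.
intros Hr Hf.
assert (H : is_cmean (fun t => (circle w r t - w) * f (circle w r t))%C ((w - w) * f w)%C).
{ apply (mean_value_holo (fun z => (z - w) * f z)%C w rho r Hr).
  intros z Hz. destruct (Hf z Hz) as [l Hl]. eexists.
  apply (is_Cderive_mult (fun z => z - w)%C f); [|exact Hl].
  apply is_Cderive_minus; [apply is_Cderive_id | apply is_Cderive_const]. }
apply (is_cmean_scal _ (/ RtoC r)%C) in H.
assert (Hr0 : RtoC r <> 0%C) by (intros E; apply RtoC_inj in E; lra).
apply is_cmean_eq with (/ RtoC r * ((w - w) * f w))%C; [|ring].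
apply is_cmean_ext with (2 := H). intros t. unfold circle. field; auto.
Qed.

Lemma cauchy_estimate (f : C -> C) (w l : C) (rho r M : R) :
  0 < r < rho -> holo_ball w rho f -> is_Cderive f w l ->
  (forall z : C, Cmod (z - w) = r -> Cmod (f z) <= M) -> Cmod l <= M / r.
Proof.
intros Hr Hf Hl HM.
apply Rle_div_r; [lra|].
replace (Cmod l * r) with (Cmod (RtoC r * l)) by (rewrite Cmod_mult, Cmod_R, Rabs_pos_eq; lra).
apply (is_cmean_le _ _ M) with (2 := cauchy_derivative f w l rho r Hr Hf Hl).
intros t _. rewrite Cmod_mult, Cmod_conj, Cmod_cis, Rmult_1_r. apply HM, Cmod_circle; lra.
Qed.

(** The formula [cauchy_derivative] is used three times on disks of decreasing radius: a
    bound on [f] bounds [f'], so [f] is Lipschitz; then [f'] is Lipschitz by the formula, so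
    the first-order expansion of [f] has a quadratic remainder, uniformly in the centre;
    integrating this expansion over a circle differentiates the formula for [f']. *)
Lemma holo_ball_derive_center (f : C -> C) (a : C) (rho : R) :
  0 < rho -> holo_ball a rho f -> ex_Cderive (C_derive f) a.
Proof.
intros HR Hf.
assert (Haa : Cmod (a - a) = 0) by (replace (a - a)%C with (RtoC 0) by ring; apply Cmod_0).
assert (Hc := holo_ball_continuous f a a rho Hf ltac:(lra)).
destruct (proj1 (Ccontinuous_eps _ _) Hc 1 Rlt_0_1) as [d0 [Hd0 HD0]].
(* The three uses of the formula take place on the disks of radius [8 d], [4 d] and [d]. *)
set (d := Rmin d0 rho / 16).
assert (Hm := Rmin_pos d0 rho Hd0 HR).
assert (Hm1 := Rmin_l d0 rho). assert (Hm2 := Rmin_r d0 rho).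
assert (Hd : 0 < d) by (unfold d; lra).
assert (HdR : 16 * d <= rho) by (unfold d; lra).
assert (Hdd : 16 * d <= d0) by (unfold d; lra).
set (M := Cmod (f a) + 1).
assert (HM : forall z, Cmod (z - a) < 16 * d -> Cmod (f z) <= M).
{ intros z Hz. generalize (Cmod_triangle_sub (f z) (f a)) (HD0 z ltac:(lra)). unfold M; lra. }
assert (HMp : 0 < M) by (unfold M; generalize (Cmod_ge_0 (f a)); lra).
assert (Hder : forall z, Cmod (z - a) < 16 * d -> is_Cderive f z (C_derive f z)).
{ intros z Hz. apply C_derive_is, Hf. lra. }
assert (Htri : forall z w r : C, Cmod (z - r) <= Cmod (z - w) + Cmod (w - r)).
{ intros z w r. replace (z - r)%C with ((z - w) + (w - r))%C by ring. apply Cmod_triangle. }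
set (M1 := M / (4 * d)).
assert (HM1p : 0 < M1) by (apply Rdiv_lt_0_compat; lra).
assert (HM1 : forall z, Cmod (z - a) < 8 * d -> Cmod (C_derive f z) <= M1).
{ intros z Hz. apply (cauchy_estimate f z _ (8 * d) (4 * d)); [lra| | |].
  - apply (holo_ball_sub f a z rho); [lra | exact Hf].
  - apply Hder; lra.
  - intros w Hw. apply HM. generalize (Htri w z a); lra. }
assert (Hseg : forall z w t s, 0 <= t <= 1 -> Cmod (z - a) < s -> Cmod (w - a) < s ->
   Cmod (z + RtoC t * (w - z) - a) < s).
{ intros z w t s Ht Hz Hw.
  replace (z + RtoC t * (w - z) - a)%C with (RtoC (1 - t) * (z - a) + RtoC t * (w - a))%C
    by (rewrite RtoC_minus; ring).
  eapply Rle_lt_trans; [apply Cmod_triangle|].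
  rewrite !Cmod_mult, !Cmod_R, !Rabs_pos_eq by lra.
  assert (Hmx := Rmax_lub_lt _ _ _ Hz Hw).
  assert (Hml := Rmax_l (Cmod (z - a)) (Cmod (w - a))).
  assert (Hmr := Rmax_r (Cmod (z - a)) (Cmod (w - a))).
  nra. }
assert (HL1 : forall z w, Cmod (z - a) < 8 * d -> Cmod (w - a) < 8 * d ->
  Cmod (f w - f z) <= M1 * Cmod (w - z)).
{ intros z w Hz Hw. apply segment_bound. intros t Ht.
  assert (Hs := Hseg z w t (8 * d) Ht Hz Hw).
  exists (C_derive f (z + RtoC t * (w - z))); split; [apply Hder; lra | apply HM1, Hs]. }
set (M2 := M1 / (2 * d)).
assert (HM2p : 0 < M2) by (apply Rdiv_lt_0_compat; lra).
assert (HL2 : forall z w, Cmod (z - a) < 4 * d -> Cmod (w - a) < 4 * d ->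
  Cmod (C_derive f w - C_derive f z) <= M2 * Cmod (w - z)).
{ intros z w Hz Hw.
  assert (Iz := cauchy_derivative f z _ (4 * d) (2 * d) ltac:(lra)
    (holo_ball_sub f a z rho (4 * d) ltac:(lra) Hf) (Hder z ltac:(lra))).
  assert (Iw := cauchy_derivative f w _ (4 * d) (2 * d) ltac:(lra)
    (holo_ball_sub f a w rho (4 * d) ltac:(lra) Hf) (Hder w ltac:(lra))).
  assert (I := is_cmean_minus _ _ _ _ Iw Iz).
  apply (is_cmean_le _ _ (M1 * Cmod (w - z))) in I.
  - replace (RtoC (2 * d) * C_derive f w - RtoC (2 * d) * C_derive f z)%C with
      (RtoC (2 * d) * (C_derive f w - C_derive f z))%C in I by ring.
    rewrite Cmod_mult, Cmod_R, Rabs_pos_eq in I by lra.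
    unfold M2. replace (M1 / (2 * d) * Cmod (w - z)) with (M1 * Cmod (w - z) / (2 * d)) by (field; lra).
    apply Rle_div_r; lra.
  - intros t _.
    replace (f (circle w (2 * d) t) * Cconj (cis t) - f (circle z (2 * d) t) * Cconj (cis t))%C
      with ((f (circle w (2 * d) t) - f (circle z (2 * d) t)) * Cconj (cis t))%C by ring.
    rewrite Cmod_mult, Cmod_conj, Cmod_cis, Rmult_1_r.
    replace (w - z)%C with (circle w (2 * d) t - circle z (2 * d) t)%C by (unfold circle; ring).
    assert (H1 := Cmod_circle z (2 * d) t ltac:(lra)).
    assert (H2 := Cmod_circle w (2 * d) t ltac:(lra)).
    apply HL1.
    + generalize (Htri (circle z (2 * d) t) z a); lra.
    + generalize (Htri (circle w (2 * d) t) w a); lra. }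
assert (HT : forall z w, Cmod (z - a) < 4 * d -> Cmod (w - a) < 4 * d ->
  Cmod (f w - f z - C_derive f z * (w - z)) <= M2 * Cmod (w - z) * Cmod (w - z)).
{ intros z w Hz Hw.
  replace (f w - f z - C_derive f z * (w - z))%C with
    ((f w - C_derive f z * w) - (f z - C_derive f z * z))%C by ring.
  apply (segment_bound (fun x => f x - C_derive f z * x)%C). intros t Ht.
  assert (Hs := Hseg z w t (4 * d) Ht Hz Hw).
  exists (C_derive f (z + RtoC t * (w - z)) - (RtoC 0 * (z + RtoC t * (w - z)) + C_derive f z * RtoC 1))%C.
  split.
  - apply is_Cderive_minus; [apply Hder; lra|].
    apply (is_Cderive_mult (fun _ => C_derive f z) (fun x => x));
      [apply is_Cderive_const | apply is_Cderive_id].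
  - replace (C_derive f (z + RtoC t * (w - z)) - (RtoC 0 * (z + RtoC t * (w - z)) + C_derive f z * RtoC 1))%C
      with (C_derive f (z + RtoC t * (w - z)) - C_derive f z)%C by ring.
    eapply Rle_trans; [apply HL2; lra|]. apply Rmult_le_compat_l; [lra|].
    replace (z + RtoC t * (w - z) - z)%C with (RtoC t * (w - z))%C by ring.
    rewrite Cmod_mult, Cmod_R, Rabs_pos_eq by lra.
    generalize (Cmod_ge_0 (w - z)); nra. }
destruct (ex_cmean (fun t => C_derive f (circle a d t) * Cconj (cis t))%C) as [m Hmm].
{ intros t. apply Rcurve_continuous_mult.
  - apply (Rcurve_continuous_comp (C_derive f) (circle a d)); [apply circle_continuous|].
    assert (Hcz := Cmod_circle a d t ltac:(lra)). set (z := circle a d t) in *.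
    apply Ccontinuous_eps; intros eps Heps.
    exists (Rmin d (eps / (M2 + 1))); split.
    { apply Rmin_pos; [lra|]. apply Rdiv_lt_0_compat; lra. }
    intros w Hw.
    assert (Hq1 := Rmin_l d (eps / (M2 + 1))). assert (Hq2 := Rmin_r d (eps / (M2 + 1))).
    eapply Rle_lt_trans; [apply HL2; generalize (Htri w z a); lra|].
    assert (Hq3 : Cmod (w - z) < eps / (M2 + 1)) by lra.
    apply Rlt_div_r in Hq3; [|lra].
    generalize (Cmod_ge_0 (w - z)); nra.
  - apply Rcurve_continuous_conj, cis_continuous. }
exists (/ RtoC d * m)%C. apply is_Cderive_eps; intros eps Heps.
set (K := M2 / d). assert (HK : 0 < K) by (apply Rdiv_lt_0_compat; lra).
exists (Rmin d (eps / K)); split.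
{ apply Rmin_pos; [lra|]. apply Rdiv_lt_0_compat; lra. }
intros w Hw.
assert (Hq1 := Rmin_l d (eps / K)). assert (Hq2 := Rmin_r d (eps / K)).
assert (Ia := cauchy_derivative f a _ (4 * d) d ltac:(lra)
    (holo_ball_sub f a a rho (4 * d) ltac:(lra) Hf) (Hder a ltac:(lra))).
assert (Iw := cauchy_derivative f w _ (4 * d) d ltac:(lra)
    (holo_ball_sub f a w rho (4 * d) ltac:(lra) Hf) (Hder w ltac:(lra))).
assert (I := is_cmean_minus _ _ _ _ (is_cmean_minus _ _ _ _ Iw Ia) (is_cmean_scal _ (w - a)%C _ Hmm)).
apply (is_cmean_le _ _ (M2 * Cmod (w - a) * Cmod (w - a))) in I.
- replace (RtoC d * C_derive f w - RtoC d * C_derive f a - (w - a) * m)%C with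
    (RtoC d * (C_derive f w - C_derive f a - / RtoC d * m * (w - a)))%C in I.
  + rewrite Cmod_mult, Cmod_R, Rabs_pos_eq in I by lra.
    apply Rle_trans with (K * Cmod (w - a) * Cmod (w - a)).
    * unfold K. replace (M2 / d * Cmod (w - a) * Cmod (w - a)) with
        (M2 * Cmod (w - a) * Cmod (w - a) / d) by (field; lra).
      apply Rle_div_r; lra.
    * apply Rmult_le_compat_r; [apply Cmod_ge_0|].
      assert (Hq3 : Cmod (w - a) < eps / K) by lra.
      apply Rlt_div_r in Hq3; lra.
  + field. intros E; apply RtoC_inj in E; lra.
- intros t _.
  replace (f (circle w d t) * Cconj (cis t) - f (circle a d t) * Cconj (cis t)
     - (w - a) * (C_derive f (circle a d t) * Cconj (cis t)))%C
    with ((f (circle w d t) - f (circle a d t) - C_derive f (circle a d t) *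
      (circle w d t - circle a d t)) * Cconj (cis t))%C by (unfold circle; ring).
  rewrite Cmod_mult, Cmod_conj, Cmod_cis, Rmult_1_r.
  replace (w - a)%C with (circle w d t - circle a d t)%C by (unfold circle; ring).
  assert (H1 := Cmod_circle a d t ltac:(lra)).
  assert (H2 := Cmod_circle w d t ltac:(lra)).
  apply HT.
  + lra.
  + generalize (Htri (circle w d t) w a); lra.
Qed.

Lemma holo_ball_derive (f : C -> C) (a : C) (rho : R) :
  holo_ball a rho f -> holo_ball a rho (C_derive f).
Proof.
intros Hf z Hz. apply (holo_ball_derive_center f z (rho - Cmod (z - a))); [lra|].
apply (holo_ball_sub f a z rho); [lra | exact Hf].
Qed.
(** * Univalent functions and omitted values *)

(** Mean value property of [1 / f]. *)
Lemma minimum_principle (f : C -> C) (a : C) (rho r c : R) :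
  0 < r < rho -> 0 < c -> Ccontinuous f a -> f a <> 0%C ->
  (forall z : C, 0 < Cmod (z - a) < rho -> ex_Cderive f z /\ f z <> 0%C) ->
  (forall t, 0 <= t <= 2 * PI -> c <= Cmod (f (circle a r t))) ->
  c <= Cmod (f a).
Proof.
intros Hr Hc Hcont Ha Hf Hb.
assert (Hinv : forall y : C, y <> 0%C -> Ccontinuous (fun w => / w)%C y).
{ intros y Hy. exact (is_Cderive_continuous _ _ _ (is_Cderive_inv_id y Hy)). }
assert (Hm : is_cmean (fun t => / f (circle a r t))%C (/ f a)%C).
{ apply (mean_value (fun z => / f z)%C a rho r Hr).
  - apply (continuous_comp f (fun w => / w)%C); [exact Hcont | now apply Hinv].
  - intros z Hz. destruct (Hf z Hz) as [[l Hl] Hn]. eexists. exact (is_Cderive_inv f z l Hn Hl). }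
assert (H : Cmod (/ f a) <= / c).
{ apply is_cmean_le with (2 := Hm). intros t Ht.
  assert (Hbt := Hb t Ht).
  rewrite Cmod_inv; [now apply Rinv_le_contravar|].
  apply Cmod_gt_0; lra. }
rewrite Cmod_inv in H by auto.
apply Cmod_gt_0 in Ha.
apply Rinv_le_contravar in H; [|now apply Rinv_0_lt_compat].
now rewrite !Rinv_inv in H.
Qed.

Definition injective_on_ball (a : C) (rho : R) (f : C -> C) : Prop :=
  forall z w : C, Cmod (z - a) < rho -> Cmod (w - a) < rho -> f z = f w -> z = w.

Lemma Cmod_self (a : C) : Cmod (a - a) = 0.
Proof. replace (a - a)%C with (RtoC 0) by ring. apply Cmod_0. Qed.

Lemma Cmod_triangle_mid (z w a : C) : Cmod (z - a) <= Cmod (z - w) + Cmod (w - a).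
Proof. replace (z - a)%C with ((z - w) + (w - a))%C by ring. apply Cmod_triangle. Qed.

Lemma injective_on_ball_sub (f : C -> C) (a b : C) (rho r : R) :
  Cmod (b - a) + r <= rho -> injective_on_ball a rho f -> injective_on_ball b r f.
Proof.
intros Hr H z w Hz Hw. apply H.
- generalize (Cmod_triangle_mid z b a); lra.
- generalize (Cmod_triangle_mid w b a); lra.
Qed.

Lemma continuous_Cmod (u : R -> C) (t : R) :
  Rcurve_continuous u t -> continuous (fun s => Cmod (u s)) t.
Proof.
rewrite Rcurve_continuous_iff; intros [H1 H2].
apply continuous_ext with (fun s => sqrt (Re (u s) * Re (u s) + Im (u s) * Im (u s))).
{ intros s. unfold Cmod, Re, Im. f_equal; ring. }
apply (continuous_comp (fun s => Re (u s) * Re (u s) + Im (u s) * Im (u s)) sqrt).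
- apply (continuous_plus (fun s => Re (u s) * Re (u s)) (fun s => Im (u s) * Im (u s)));
    now apply (continuous_mult (K := R_AbsRing)).
- apply continuous_sqrt.
Qed.

(** Injectivity makes the distance positive along the circle, and a continuous positive
    function has a positive minimum on a period. *)
Lemma circle_gap (f : C -> C) (a : C) (rho r : R) :
  0 < r < rho -> holo_ball a rho f -> injective_on_ball a rho f ->
  exists c, 0 < c /\ forall t, 0 <= t <= 2 * PI -> c <= Cmod (f (circle a r t) - f a).
Proof.
intros Hr Hf Hi.
destruct (continuity_ab_min (fun t => Cmod (f (circle a r t) - f a)) 0 (2 * PI)) as [t0 [Hmin Ht0]].
{ apply Rlt_le, two_PI_pos. }
{ intros t _. apply continuity_pt_filterlim. apply continuous_Cmod.
  apply (Rcurve_continuous_plus (fun t => f (circle a r t)) (fun _ => - f a)%C);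
    [|apply Rcurve_continuous_const].
  now apply (circle_comp_continuous f a rho). }
exists (Cmod (f (circle a r t0) - f a)); split; [|exact Hmin].
apply Cmod_gt_0, Cminus_eq_contra. intros E.
assert (Hc := Cmod_circle a r t0 ltac:(lra)).
apply Hi in E; [|lra|rewrite Cmod_self; lra].
rewrite E, Cmod_self in Hc; lra.
Qed.

(** Minimum principle for the difference quotient at [a], which has no zero because [f] is
    injective and [l <> 0].  It says that [f] cannot push a whole circle of radius [r] further
    than [r |f' a|] from [f a]. *)
Lemma univalent_circle_gap_le (f : C -> C) (a l : C) (rho r c : R) :
  0 < r < rho -> 0 < c -> holo_ball a rho f -> injective_on_ball a rho f ->
  is_Cderive f a l -> l <> 0%C ->
  (forall t, 0 <= t <= 2 * PI -> c <= Cmod (f (circle a r t) - f a)) ->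
  c <= r * Cmod l.
Proof.
intros Hr Hc Hf Hi Hl Hl0 Hb.
set (Q := fun z => if Ceq_dec z a then l else ((f z - f a) / (z - a))%C).
assert (HQa : Q a = l) by (unfold Q; destruct (Ceq_dec a a) as [_|N]; [reflexivity | now elim N]).
assert (HQ : forall z, z <> a -> Q z = ((f z - f a) / (z - a))%C).
{ intros z N. unfold Q. now destruct (Ceq_dec z a). }
assert (H : c / r <= Cmod (Q a)).
{ apply (minimum_principle Q a rho r); auto.
  - apply Rdiv_lt_0_compat; lra.
  - now apply difference_quotient_continuous.
  - now rewrite HQa.
  - intros z [Hz1 Hz2].
    assert (Hza : z <> a) by (intros ->; rewrite Cmod_self in Hz1; lra).
    split; [apply difference_quotient_derive; auto|].
    rewrite HQ by auto. intros E.
    assert (Hn := Cminus_eq_contra _ _ Hza).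
    apply Hza, Hi; [lra | rewrite Cmod_self; lra |].
    apply (proj2 (Ceq_minus _ _)).
    replace (f z - f a)%C with ((f z - f a) / (z - a) * (z - a))%C by (field; auto).
    rewrite E; ring.
  - intros t Ht. assert (Hcc := Cmod_circle a r t ltac:(lra)).
    assert (Hza : circle a r t <> a) by (intros E; rewrite E, Cmod_self in Hcc; lra).
    rewrite HQ, Cmod_div, Hcc by (auto; now apply Cminus_eq_contra).
    apply Rmult_le_compat_r; [apply Rlt_le, Rinv_0_lt_compat; lra | now apply Hb]. }
rewrite HQa in H. apply Rle_div_l in H; lra.
Qed.

(** Suppose [f' a = 0].  The image of a circle of fixed small radius about a nearby point [b]
    keeps a distance at least [c / 2] from [f b], so [univalent_circle_gap_le] bounds [|f' b|] from
    below whenever it is nonzero.  By continuity of [f'] at [a] this forces [f'] to vanish near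
    [a], where [f] is then constant, against injectivity. *)
Lemma univalent_derive_neq_0 (f : C -> C) (a : C) (rho : R) :
  0 < rho -> holo_ball a rho f -> injective_on_ball a rho f -> C_derive f a <> 0%C.
Proof.
intros HR Hf Hi E.
assert (Hf' := holo_ball_derive f a rho Hf).
assert (Hc' := holo_ball_continuous _ a a rho Hf' ltac:(rewrite Cmod_self; lra)).
assert (Hder : forall z, Cmod (z - a) < rho -> is_Cderive f z (C_derive f z)).
{ intros z Hz. now apply C_derive_is, Hf. }
destruct (proj1 (Ccontinuous_eps _ _) Hc' 1 Rlt_0_1) as [d0 [Hd0 HD0]].
set (d := Rmin d0 rho).
assert (Hd : 0 < d) by now apply Rmin_pos.
assert (Hd1 : d <= d0) by apply Rmin_l. assert (Hd2 : d <= rho) by apply Rmin_r.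
assert (Hsmall : forall M z w, (forall x, Cmod (x - a) < d -> Cmod (x - a) <= Rmax (Cmod (z - a)) (Cmod (w - a)) ->
    Cmod (C_derive f x) <= M) ->
  Cmod (z - a) < d -> Cmod (w - a) < d -> Cmod (f w - f z) <= M * Cmod (w - z)).
{ intros M z w HM Hz Hw. apply segment_bound. intros t Ht.
  assert (Hx : Cmod (z + RtoC t * (w - z) - a) <= Rmax (Cmod (z - a)) (Cmod (w - a))).
  { replace (z + RtoC t * (w - z) - a)%C with (RtoC (1 - t) * (z - a) + RtoC t * (w - a))%C
      by (rewrite RtoC_minus; ring).
    eapply Rle_trans; [apply Cmod_triangle|].
    rewrite !Cmod_mult, !Cmod_R, !Rabs_pos_eq by lra.
    assert (Hml := Rmax_l (Cmod (z - a)) (Cmod (w - a))).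
    assert (Hmr := Rmax_r (Cmod (z - a)) (Cmod (w - a))). nra. }
  assert (Hx2 : Cmod (z + RtoC t * (w - z) - a) < d).
  { eapply Rle_lt_trans; [exact Hx|]. now apply Rmax_lub_lt. }
  eexists; split; [apply Hder; lra | now apply HM]. }
assert (Hlip : forall z w, Cmod (z - a) < d -> Cmod (w - a) < d -> Cmod (f w - f z) <= Cmod (w - z)).
{ intros z w Hz Hw. rewrite <- (Rmult_1_l (Cmod (w - z))). apply Hsmall; auto.
  intros x Hx _. specialize (HD0 x ltac:(lra)). rewrite E in HD0.
  replace (C_derive f x - 0)%C with (C_derive f x) in HD0 by ring. lra. }
set (r := d / 4).
destruct (circle_gap f a rho r ltac:(unfold r; lra) Hf Hi) as [c [Hc Hgap]].
destruct (proj1 (Ccontinuous_eps _ _) Hc' (c / (2 * r)) ltac:(apply Rdiv_lt_0_compat; unfold r; lra))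
  as [d3 [Hd3 HD3]].
set (e := Rmin d3 (Rmin (c / 4) r)).
assert (He : 0 < e) by (unfold e, r; repeat apply Rmin_pos; lra).
assert (He1 : e <= d3) by apply Rmin_l.
assert (He2 : e <= c / 4) by (eapply Rle_trans; [apply Rmin_r | apply Rmin_l]).
assert (He3 : e <= r) by (eapply Rle_trans; [apply Rmin_r | apply Rmin_r]).
assert (Hzero : forall b, Cmod (b - a) < e -> C_derive f b = RtoC 0).
{ intros b Hb. destruct (Ceq_dec (C_derive f b) 0) as [H0|H0]; [exact H0|exfalso].
  assert (HH : c / 2 <= r * Cmod (C_derive f b)).
  { apply (univalent_circle_gap_le f b _ (d / 2) r); [unfold r; lra | lra | | | | exact H0 |].
    - apply (holo_ball_sub f a b rho); [unfold r in *; lra | exact Hf].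
    - apply (injective_on_ball_sub f a b rho); [unfold r in *; lra | exact Hi].
    - apply Hder; unfold r in *; lra.
    - intros t Ht.
      assert (Ha := Hgap t Ht).
      assert (Ca := Cmod_circle a r t ltac:(unfold r; lra)).
      assert (Cb := Cmod_circle b r t ltac:(unfold r; lra)).
      assert (T1 := Cmod_triangle_mid (circle b r t) b a).
      assert (L1 := Hlip (circle b r t) (circle a r t) ltac:(unfold r in *; lra) ltac:(unfold r in *; lra)).
      assert (L2 := Hlip a b ltac:(rewrite Cmod_self; lra) ltac:(unfold r in *; lra)).
      replace (circle a r t - circle b r t)%C with (a - b)%C in L1 by (unfold circle; ring).
      rewrite (Cmod_minus_sym a b) in L1.
      replace (f (circle a r t) - f a)%C with ((f (circle a r t) - f (circle b r t))
        + ((f (circle b r t) - f b) + (f b - f a)))%C in Ha by ring.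
      generalize (Cmod_triangle (f (circle a r t) - f (circle b r t))
        ((f (circle b r t) - f b) + (f b - f a)))
        (Cmod_triangle (f (circle b r t) - f b) (f b - f a)). lra. }
  specialize (HD3 b ltac:(lra)). rewrite E in HD3.
  replace (C_derive f b - 0)%C with (C_derive f b) in HD3 by ring.
  apply Rlt_div_r in HD3; unfold r in *; lra. }
set (b := (a + RtoC (e / 2))%C).
assert (Hb : Cmod (b - a) = e / 2).
{ unfold b. replace (a + RtoC (e / 2) - a)%C with (RtoC (e / 2)) by ring.
  rewrite Cmod_R, Rabs_pos_eq; lra. }
assert (Hfb : Cmod (f b - f a) <= 0 * Cmod (b - a)).
{ apply Hsmall; [|rewrite Cmod_self; lra | unfold r in *; lra].
  intros x _ Hx. rewrite Hzero, Cmod_0; [lra|].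
  eapply Rle_lt_trans; [exact Hx|]. rewrite Cmod_self, Hb. apply Rmax_lub_lt; lra. }
rewrite Rmult_0_l in Hfb.
assert (E0 : (f b - f a)%C = RtoC 0).
{ apply Cmod_eq_0, Rle_antisym; [exact Hfb | apply Cmod_ge_0]. }
apply (proj2 (Ceq_minus _ _)) in E0.
apply Hi in E0; [|unfold r in *; lra | rewrite Cmod_self; lra].
rewrite E0, Cmod_self in Hb. lra.
Qed.

(** A form of openness of [f] at [a] that avoids the open mapping theorem.  If [z] is far from
    [a], then [f z - f b] has no zero for [b] near [a], so the minimum principle in the
    variable [b] keeps [f z] away from [f a].  Hence a point whose image is close to [f a] stays
    away from the unit circle. *)
Lemma univalent_separation (f : C -> C) (a : C) :
  holo_ball (RtoC 0) 1 f -> injective_on_ball (RtoC 0) 1 f -> Cmod a < 1 ->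
  exists e, 0 < e /\ forall z, Cmod z < 1 -> Cmod (f z - f a) < 2 * e -> Cmod z < 1 - e.
Proof.
intros Hf Hi Ha.
set (s := 1 - Cmod a).
assert (Hs : 0 < s) by (unfold s; lra).
assert (Ha0 : Cmod (a - RtoC 0) = Cmod a) by (f_equal; ring).
assert (Hfa : holo_ball a s f) by (apply (holo_ball_sub f (RtoC 0) a 1); [unfold s; lra | exact Hf]).
assert (Hia : injective_on_ball a s f)
  by (apply (injective_on_ball_sub f (RtoC 0) a 1); [unfold s; lra | exact Hi]).
destruct (circle_gap f a s (s / 4) ltac:(lra) Hfa Hia) as [c [Hc Hgap]].
exists (Rmin (c / 4) (s / 4)); split; [apply Rmin_pos; lra|].
assert (Hm1 := Rmin_l (c / 4) (s / 4)). assert (Hm2 := Rmin_r (c / 4) (s / 4)).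
intros z Hz Hfz.
assert (Hz0 : Cmod (z - RtoC 0) = Cmod z) by (f_equal; ring).
destruct (Rlt_le_dec (Cmod (z - a)) (s / 2)) as [Hza|Hza].
{ generalize (Cmod_triangle_sub z a). unfold s in *; lra. }
exfalso.
assert (HH : c / 2 <= Cmod (f z - f a)).
{ assert (Hne : forall b, Cmod (b - a) < s / 2 -> (f z - f b)%C <> 0%C).
  { intros b Hb E. apply (proj2 (Ceq_minus _ _)) in E.
    apply Hi in E; [subst b; lra | lra |].
    generalize (Cmod_triangle_mid b a (RtoC 0)); unfold s in *; lra. }
  assert (Hd : forall b, Cmod (b - a) < s / 2 -> ex_Cderive (fun b => f z - f b)%C b).
  { intros b Hb. destruct (Hfa b ltac:(lra)) as [l Hl]. eexists.
    apply is_Cderive_minus; [apply is_Cderive_const | exact Hl]. }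
  apply (minimum_principle (fun b => f z - f b)%C a (s / 2) (s / 4)).
  - lra.
  - lra.
  - destruct (Hd a ltac:(rewrite Cmod_self; lra)) as [l Hl]. now apply is_Cderive_continuous with l.
  - apply Hne. rewrite Cmod_self; lra.
  - intros b Hb; split; [apply Hd | apply Hne]; lra.
  - intros t Ht. specialize (Hgap t Ht).
    replace (f (circle a (s / 4) t) - f a)%C with
      ((f z - f a) - (f z - f (circle a (s / 4) t)))%C in Hgap by ring.
    generalize (Cmod_minus_le (f z - f a) (f z - f (circle a (s / 4) t))). lra. }
lra.
Qed.

(** Otherwise [f] covers the compact square of half-side [|f' 0|] about [f 0], and
    [univalent_separation] with compactness of the square gives a uniform [d] such that [z]
    stays at distance [d] from the unit circle whenever [f z] lies in the square.  But on
    every circle about 0 in the disk some point is mapped to distance less than [|f' 0|] from [f 0], by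
    [univalent_circle_gap_le]. *)
Lemma omitted_value (f : C -> C) :
  holo_ball (RtoC 0) 1 f -> injective_on_ball (RtoC 0) 1 f ->
  exists w : C, Cmod (w - f (RtoC 0)) <= 2 * Cmod (C_derive f (RtoC 0)) /\
    forall z, Cmod z < 1 -> f z <> w.
Proof.
intros Hf Hi.
set (D := Cmod (C_derive f (RtoC 0))). set (p := f (RtoC 0)).
assert (HD0 := univalent_derive_neq_0 f (RtoC 0) 1 Rlt_0_1 Hf Hi).
assert (HD : 0 < D) by now apply Cmod_gt_0.
apply NNPP; intros Hno.
assert (Hcov : forall u v, exists e : posreal, Re p - D <= u <= Re p + D -> Im p - D <= v <= Im p + D ->
  forall z, Cmod z < 1 -> Cmod (f z - (u, v)) < 2 * e -> Cmod z < 1 - e).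
{ intros u v.
  destruct (classic (Re p - D <= u <= Re p + D /\ Im p - D <= v <= Im p + D)) as [[Hu Hv]|N].
  2:{ exists (mkposreal 1 Rlt_0_1). intros; exfalso; tauto. }
  destruct (classic (exists a, Cmod a < 1 /\ f a = (u, v))) as [[a [Ha Ea]]|N].
  - destruct (univalent_separation f a Hf Hi Ha) as [e [He HE]].
    exists (mkposreal e He). intros _ _. now rewrite <- Ea.
  - exfalso; apply Hno. exists (u, v); split.
    + eapply Rle_trans; [apply Cmod_le_Re_Im|].
      assert (H1 : Rabs (Re ((u, v) - p)%C) <= D).
      { unfold Cminus, Cplus, Copp, Re in *; simpl in *. apply Rabs_le; lra. }
      assert (H2 : Rabs (Im ((u, v) - p)%C) <= D).
      { unfold Cminus, Cplus, Copp, Im in *; simpl in *. apply Rabs_le; lra. }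
      unfold p in *; lra.
    + intros z Hz E. apply N. now exists z. }
set (delta := fun u v => proj1_sig (constructive_indefinite_description _ (Hcov u v))).
assert (Hdelta : forall u v, Re p - D <= u <= Re p + D -> Im p - D <= v <= Im p + D ->
  forall z, Cmod z < 1 -> Cmod (f z - (u, v)) < 2 * delta u v -> Cmod z < 1 - delta u v).
{ intros u v. unfold delta. now destruct (constructive_indefinite_description _ (Hcov u v)). }
destruct (compactness_value_2d (Re p - D) (Re p + D) (Im p - D) (Im p + D) delta) as [d Hd].
assert (Hdp := cond_pos d).
(* Radius of a circle outside the set reached by the covering; [/ 2] keeps it positive. *)
set (r := 1 - Rmin d (/ 2)).
assert (Hr1 := Rmin_l d (/ 2)). assert (Hr2 := Rmin_r d (/ 2)).
assert (Hr3 := Rmin_pos d (/ 2) Hdp ltac:(lra)).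
assert (Hr : 0 < r < 1) by (unfold r; lra).
assert (Hex : exists t, Cmod (f (circle (RtoC 0) r t) - p) < D).
{ apply NNPP; intros N.
  assert (HH : D <= r * D).
  { apply (univalent_circle_gap_le f (RtoC 0) _ 1 r D Hr HD Hf Hi).
    - apply C_derive_is, Hf. rewrite Cmod_self; lra.
    - exact HD0.
    - intros t _. apply Rnot_lt_le. intros L. apply N. now exists t. }
  nra. }
destruct Hex as [t Ht].
assert (Hc := Cmod_circle (RtoC 0) r t ltac:(lra)).
set (z := circle (RtoC 0) r t) in *.
replace (z - RtoC 0)%C with z in Hc by ring.
assert (HRe := Re_le_Cmod (f z - p)). assert (HIm := Im_le_Cmod (f z - p)).
apply (Hd (Re (f z)) (Im (f z))).
- assert (H := Rle_lt_trans _ _ _ HRe Ht). apply Rabs_lt_between in H.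
  unfold Cminus, Cplus, Copp, Re in *; simpl in *; lra.
- assert (H := Rle_lt_trans _ _ _ HIm Ht). apply Rabs_lt_between in H.
  unfold Cminus, Cplus, Copp, Im, p in *; simpl in *; lra.
- intros [u [v [Hu [Hv [H1 [H2 H3]]]]]].
  assert (Hz : Cmod z < 1 - delta u v).
  { apply Hdelta; auto; [lra|].
    eapply Rle_lt_trans; [apply Cmod_le_Re_Im|].
    change (Rabs (Re (f z) - u) + Rabs (Im (f z) - v) < 2 * delta u v); lra. }
  unfold r in Hc; lra.
Qed.
(** * Functions of positive real part *)

Lemma Rmult_le_limit (rho x y : R) :
  0 < rho -> 0 <= x -> (forall r, 0 < r < rho -> r * x <= y) -> rho * x <= y.
Proof.
intros HR Hx H. apply Rnot_lt_le; intros L.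
assert (Hx0 : 0 < x) by (destruct Hx as [Hx|<-]; [exact Hx | generalize (H (rho / 2) ltac:(lra)); lra]).
assert (Hy : 0 <= y) by (generalize (H (rho / 2) ltac:(lra)); nra).
assert (Hq : y / x < rho) by (apply Rlt_div_l; lra).
assert (Hq0 : 0 <= y / x) by (apply Rdiv_le_0_compat; lra).
assert (HH := H ((rho + y / x) / 2) ltac:(lra)).
replace ((rho + y / x) / 2 * x) with ((rho * x + y) / 2) in HH by (field; lra). lra.
Qed.

(** Subtracting the conjugate of the vanishing mean of [f cis] from the formula for [f'] gives
    [r f' w] as the mean of [2 Re f conj (cis t)], and the mean of [Re f] is [Re (f w)]. *)
Lemma half_plane_derivative (f : C -> C) (w : C) (rho : R) :
  0 < rho -> holo_ball w rho f -> (forall z, Cmod (z - w) < rho -> 0 <= Re (f z)) ->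
  rho * Cmod (C_derive f w) <= 2 * Re (f w).
Proof.
intros HR Hf Hpos. apply Rmult_le_limit; [exact HR | apply Cmod_ge_0|].
intros r Hr.
assert (Hl : is_Cderive f w (C_derive f w)).
{ apply C_derive_is, Hf. rewrite Cmod_self; lra. }
assert (I1 := cauchy_derivative f w _ rho r Hr Hf Hl).
assert (I2 := is_cmean_scal _ (RtoC (-1)) _ (is_cmean_conj _ _ (cauchy_vanishing f w rho r Hr Hf))).
assert (I := is_cmean_minus _ _ _ _ I1 I2).
apply is_cmean_eq with (n := (RtoC r * C_derive f w)%C) in I.
2:{ unfold Cconj, Cmult, Cminus, Cplus, Copp, RtoC; simpl; f_equal; ring. }
replace (r * Cmod (C_derive f w)) with (Cmod (RtoC r * C_derive f w))
  by (rewrite Cmod_mult, Cmod_R, Rabs_pos_eq; lra).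
apply (is_cmean_bound _ _ _ _ 2) with (2 := I) (3 := mean_value_holo f w rho r Hr Hf).
intros t _.
replace (f (circle w r t) * Cconj (cis t) - RtoC (-1) * Cconj (f (circle w r t) * cis t))%C
  with (RtoC (2 * Re (f (circle w r t))) * Cconj (cis t))%C
  by (unfold Cconj, Cmult, Cminus, Cplus, Copp, RtoC, Re; simpl; f_equal; ring).
rewrite Cmod_mult, Cmod_conj, Cmod_cis, Cmod_R, Rabs_pos_eq; [lra|].
apply Rmult_le_pos; [lra|]. apply Hpos. rewrite Cmod_circle; lra.
Qed.

(** The bound of [half_plane_derivative], used at the points of the circle of radius
    [rho / 2], is inserted into the formula for the derivative of [f']; averaging [Re f] again
    returns [Re (f w)]. *)
Lemma half_plane_second_derivative (f : C -> C) (w : C) (rho : R) :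
  0 < rho -> holo_ball w rho f -> (forall z, Cmod (z - w) < rho -> 0 <= Re (f z)) ->
  rho ^ 2 * Cmod (C_derive (C_derive f) w) <= 8 * Re (f w).
Proof.
intros HR Hf Hpos.
assert (Hf' := holo_ball_derive f w rho Hf).
assert (Hl : is_Cderive (C_derive f) w (C_derive (C_derive f) w)).
{ apply C_derive_is, Hf'. rewrite Cmod_self; lra. }
assert (Hr : 0 < rho / 2 < rho) by lra.
assert (I := cauchy_derivative (C_derive f) w _ rho (rho / 2) Hr Hf' Hl).
assert (H : Cmod (RtoC (rho / 2) * C_derive (C_derive f) w) <= 4 / rho * Re (f w)).
{ apply (is_cmean_bound _ _ _ _ (4 / rho)) with (2 := I) (3 := mean_value_holo f w rho (rho / 2) Hr Hf).
  intros t _. rewrite Cmod_mult, Cmod_conj, Cmod_cis, Rmult_1_r.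
  assert (Hc := Cmod_circle w (rho / 2) t ltac:(lra)). set (z := circle w (rho / 2) t) in *.
  assert (HH : rho / 2 * Cmod (C_derive f z) <= 2 * Re (f z)).
  { apply half_plane_derivative; [lra | apply (holo_ball_sub f w z rho); [lra | exact Hf] |].
    intros y Hy. apply Hpos. generalize (Cmod_triangle_mid y z w); lra. }
  replace (4 / rho * Re (f z)) with (2 * Re (f z) / (rho / 2)) by (field; lra).
  apply Rle_div_r; lra. }
rewrite Cmod_mult, Cmod_R, Rabs_pos_eq in H by lra.
replace (8 * Re (f w)) with (2 * rho * (4 / rho * Re (f w))) by (field; lra).
replace (rho ^ 2 * Cmod (C_derive (C_derive f) w)) with
  (2 * rho * (rho / 2 * Cmod (C_derive (C_derive f) w))) by field.
apply Rmult_le_compat_l; lra.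
Qed.

Lemma disk_ball (z : C) : Cmod (z - RtoC 0) = Cmod z.
Proof. f_equal; ring. Qed.

Lemma analytic_holo_ball (f : C -> C) : analytic_in_disk f -> holo_ball (RtoC 0) 1 f.
Proof. intros H z Hz. apply H. unfold disk. now rewrite <- disk_ball. Qed.

Lemma analytic_sub_ball (f : C -> C) (w : C) :
  analytic_in_disk f -> holo_ball w (1 - Cmod w) f.
Proof.
intros H. apply (holo_ball_sub f (RtoC 0) w 1); [rewrite disk_ball; lra|].
now apply analytic_holo_ball.
Qed.

Lemma in_sub_ball (z w : C) : Cmod (z - w) < 1 - Cmod w -> disk z.
Proof. unfold disk. generalize (Cmod_triangle_sub z w); lra. Qed.

Lemma analytic_derive (f : C -> C) : analytic_in_disk f -> analytic_in_disk (C_derive f).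
Proof.
intros H z Hz. apply (holo_ball_derive f (RtoC 0) 1 (analytic_holo_ball f H)).
now rewrite disk_ball.
Qed.

(** The Cayley transform [m = (1 + q) / (1 - q)] has positive real part
    [(1 - |q|^2) / |1 - q|^2] and derivative [2 q' / (1 - q)^2]. *)
Lemma schwarz_pick (q : C -> C) (w : C) :
  analytic_in_disk q -> (forall z, disk z -> Cmod (q z) < 1) -> disk w ->
  (1 - Cmod w) * Cmod (C_derive q w) <= 1 - Cmod (q w) ^ 2.
Proof.
intros Hq Hb Hw. unfold disk in Hw.
assert (Hn : forall z, disk z -> (RtoC 1 - q z)%C <> 0%C).
{ intros z Hz E. apply (proj2 (Ceq_minus _ _)) in E.
  specialize (Hb z Hz). rewrite <- E, Cmod_1 in Hb; lra. }
set (m := fun z => ((RtoC 1 + q z) / (RtoC 1 - q z))%C).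
assert (Hm : forall z, disk z ->
  is_Cderive m z (RtoC 2 * C_derive q z / ((RtoC 1 - q z) * (RtoC 1 - q z)))%C).
{ intros z Hz. assert (Hl := C_derive_is q z (Hq z Hz)). eapply is_Cderive_eq.
  - apply (is_Cderive_div (fun z => RtoC 1 + q z)%C (fun z => RtoC 1 - q z)%C); [now apply Hn| |].
    + exact (is_Cderive_plus (fun _ => RtoC 1) q z _ _ (is_Cderive_const _ _) Hl).
    + exact (is_Cderive_minus (fun _ => RtoC 1) q z _ _ (is_Cderive_const _ _) Hl).
  - field. now apply Hn. }
assert (HRe : forall z, disk z -> Re (m z) = (1 - Cmod (q z) ^ 2) / Cmod (RtoC 1 - q z) ^ 2).
{ intros z Hz. assert (Hnz := Hn z Hz). apply Cmod_gt_0 in Hnz.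
  rewrite !Cmod_sqr.
  assert (Hsq : 0 < Re (RtoC 1 - q z) ^ 2 + Im (RtoC 1 - q z) ^ 2).
  { rewrite <- Cmod_sqr. apply pow_lt; exact Hnz. }
  unfold m. destruct (q z) as [x y].
  unfold Re, Im, Cdiv, Cinv, Cminus, Cmult, Cplus, Copp, RtoC in *; simpl in *.
  field. lra. }
assert (H := half_plane_derivative m w (1 - Cmod w) ltac:(lra)).
rewrite (is_C_derive_unique _ _ _ (Hm w Hw)), (HRe w Hw) in H.
assert (Hnw := proj1 (Cmod_gt_0 _) (Hn w Hw)).
rewrite Cmod_div, !Cmod_mult, Cmod_R, (Rabs_pos_eq 2) in H
  by (try lra; apply Cmult_neq_0; now apply Hn).
set (N := Cmod (RtoC 1 - q w)) in *.
assert (HH : (1 - Cmod w) * (2 * Cmod (C_derive q w) / (N * N)) <= 2 * ((1 - Cmod (q w) ^ 2) / N ^ 2)).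
{ apply H.
  - intros z Hz. eexists. apply Hm. now apply (in_sub_ball z w).
  - intros z Hz. assert (Hz' := in_sub_ball z w Hz). rewrite HRe by exact Hz'.
    apply Rdiv_le_0_compat.
    + generalize (Hb z Hz') (Cmod_ge_0 (q z)); nra.
    + apply pow_lt. apply Cmod_gt_0. now apply Hn. }
apply Rmult_le_reg_l with (2 / (N * N)).
- apply Rdiv_lt_0_compat; [lra | now apply Rmult_lt_0_compat].
- eapply Rle_trans; [|eapply Rle_trans; [exact HH|]]; right; field; lra.
Qed.

(** * Disk automorphisms and omitted values near an arbitrary point *)

Definition moebius (b z : C) : C := ((z + b) / (RtoC 1 + Cconj b * z))%C.

Lemma moebius_denom (b z : C) : disk b -> disk z -> (RtoC 1 + Cconj b * z)%C <> 0%C.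
Proof.
unfold disk; intros Hb Hz E.
assert (H : Cmod (RtoC 1) <= Cmod (Cconj b * z)).
{ replace (RtoC 1) with (- (Cconj b * z))%C.
  - now rewrite Cmod_opp; right.
  - transitivity (RtoC 1 - (RtoC 1 + Cconj b * z))%C; [ring|]. rewrite E; ring. }
rewrite Cmod_1, Cmod_mult, Cmod_conj in H.
generalize (Cmod_ge_0 b) (Cmod_ge_0 z). nra.
Qed.

Lemma moebius_disk (b z : C) : disk b -> disk z -> disk (moebius b z).
Proof.
intros Hb Hz. assert (Hd := moebius_denom b z Hb Hz).
unfold disk, moebius in *. rewrite Cmod_div by exact Hd.
apply Cmod_gt_0 in Hd. apply Rlt_div_l; [exact Hd|]. rewrite Rmult_1_l.
assert (E : Cmod (RtoC 1 + Cconj b * z) ^ 2 - Cmod (z + b) ^ 2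
  = (1 - Cmod b ^ 2) * (1 - Cmod z ^ 2)).
{ rewrite !Cmod_sqr. destruct b, z.
  unfold Re, Im, Cconj, Cmult, Cplus, RtoC; simpl; ring. }
assert (H1 : 0 < 1 - Cmod b ^ 2) by (generalize (Cmod_ge_0 b); nra).
assert (H2 : 0 < 1 - Cmod z ^ 2) by (generalize (Cmod_ge_0 z); nra).
assert (H3 := Rmult_lt_0_compat _ _ H1 H2). rewrite <- E in H3.
assert (H4 := Cmod_ge_0 (z + b)). nra.
Qed.

Lemma Cconj_mult_self (b : C) : (b * Cconj b)%C = RtoC (Cmod b ^ 2).
Proof.
rewrite Cmod_sqr. destruct b.
unfold Re, Im, Cconj, Cmult, RtoC; simpl; f_equal; ring.
Qed.

Lemma one_minus_sqr_neq_0 (b : C) : disk b -> (RtoC 1 - b * Cconj b)%C <> 0%C.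
Proof.
unfold disk; intros Hb E. rewrite Cconj_mult_self, <- RtoC_minus in E.
apply RtoC_inj in E. generalize (Cmod_ge_0 b); nra.
Qed.

Lemma Cconj_opp (b : C) : Cconj (- b) = (- Cconj b)%C.
Proof. reflexivity. Qed.

Lemma disk_opp (b : C) : disk b -> disk (- b).
Proof. unfold disk; now rewrite Cmod_opp. Qed.

Lemma moebius_cancel (b z : C) : disk b -> disk z -> moebius b (moebius (- b) z) = z.
Proof.
intros Hb Hz. assert (H1 := one_minus_sqr_neq_0 b Hb).
assert (H2 := moebius_denom (- b) z (disk_opp b Hb) Hz).
assert (H3 := moebius_denom b _ Hb (moebius_disk _ _ (disk_opp b Hb) Hz)).
unfold moebius in *. rewrite Cconj_opp in *.
assert (E : (RtoC 1 + Cconj b * ((z + - b) / (RtoC 1 + - Cconj b * z)))%C =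
  ((RtoC 1 - b * Cconj b) / (RtoC 1 + - Cconj b * z))%C) by (field; exact H2).
rewrite E. field. split; assumption.
Qed.

Lemma is_Cderive_moebius (b z : C) : disk b -> disk z ->
  is_Cderive (moebius b) z ((RtoC 1 - b * Cconj b) / ((RtoC 1 + Cconj b * z) * (RtoC 1 + Cconj b * z)))%C.
Proof.
intros Hb Hz. assert (H := moebius_denom b z Hb Hz).
eapply is_Cderive_eq.
- apply (is_Cderive_div (fun z => z + b)%C (fun z => RtoC 1 + Cconj b * z)%C); [exact H| |].
  + apply is_Cderive_plus; [apply is_Cderive_id | apply is_Cderive_const].
  + apply is_Cderive_plus; [apply is_Cderive_const|].
    apply (is_Cderive_mult (fun _ => Cconj b) (fun z => z));
      [apply is_Cderive_const | apply is_Cderive_id].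
- field. exact H.
Qed.

(** Precomposition with the automorphism that sends 0 to [b] keeps the range, and multiplies
    the derivative by [1 - |b|^2 <= 2 (1 - |b|)]. *)
Lemma omitted_value_near (f : C -> C) (b : C) :
  analytic_in_disk f -> univalent_in_disk f -> disk b ->
  exists w : C, Cmod (w - f b) <= 4 * (1 - Cmod b) * Cmod (C_derive f b) /\
    forall z, disk z -> f z <> w.
Proof.
intros Hf Hi Hb.
assert (Hb0 : moebius b (RtoC 0) = b).
{ unfold moebius. field. }
assert (H0 : disk (RtoC 0)) by (unfold disk; rewrite Cmod_0; lra).
set (F := fun z => f (moebius b z)).
assert (HF : forall z, disk z -> is_Cderive F z (C_derive f (moebius b z) *
  ((RtoC 1 - b * Cconj b) / ((RtoC 1 + Cconj b * z) * (RtoC 1 + Cconj b * z))))%C).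
{ intros z Hz. apply (is_Cderive_comp f (moebius b)); [|now apply is_Cderive_moebius].
  apply C_derive_is, Hf. now apply moebius_disk. }
destruct (omitted_value F) as [w [Hw1 Hw2]].
- intros z Hz. rewrite disk_ball in Hz. eexists. now apply HF.
- intros z w Hz Hw E. rewrite disk_ball in Hz, Hw.
  apply Hi in E; [|now apply moebius_disk | now apply moebius_disk].
  assert (Hc : forall x, disk x -> moebius (- b) (moebius b x) = x).
  { intros x Hx. replace b with (- - b)%C at 2 by ring.
    apply moebius_cancel; [now apply disk_opp | exact Hx]. }
  rewrite <- (Hc z), <- (Hc w), E by assumption. reflexivity.
- exists w; split.
  + rewrite (is_C_derive_unique _ _ _ (HF _ H0)) in Hw1.
    unfold F in Hw1. rewrite Hb0, Cmod_mult in Hw1.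
    replace ((RtoC 1 - b * Cconj b) / ((RtoC 1 + Cconj b * 0) * (RtoC 1 + Cconj b * 0)))%C
      with (RtoC (1 - Cmod b ^ 2)) in Hw1.
    2:{ rewrite Cconj_mult_self, RtoC_minus. field. }
    unfold disk in Hb. assert (Hbp := Cmod_ge_0 b). assert (Hdp := Cmod_ge_0 (C_derive f b)).
    rewrite Cmod_R, Rabs_pos_eq in Hw1 by nra.
    assert (1 - Cmod b ^ 2 <= 2 * (1 - Cmod b)) by nra.
    eapply Rle_trans; [exact Hw1|].
    assert (Cmod (C_derive f b) * (1 - Cmod b ^ 2) <= Cmod (C_derive f b) * (2 * (1 - Cmod b)))
      by (apply Rmult_le_compat_l; lra).
    lra.
  + intros z Hz E. apply (Hw2 (moebius (- b) z)).
    * now apply moebius_disk; [apply disk_opp|].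
    * unfold F. now rewrite moebius_cancel.
Qed.

(** * Omitted rays, square roots and the pre-Schwarzian *)

(** The principal branch of the square root, off the nonpositive reals. *)
Definition Csqrt (w : C) : C :=
  (sqrt ((Cmod w + Re w) / 2), Im w / (2 * sqrt ((Cmod w + Re w) / 2))).

Lemma Csqrt_spec (w : C) : (Im w = 0 -> 0 < Re w) ->
  0 < Re (Csqrt w) /\ (Csqrt w * Csqrt w)%C = w.
Proof.
intros H.
assert (Hm := Cmod_sqr w). assert (Hm0 := Cmod_ge_0 w).
assert (Hpos : 0 < Cmod w + Re w).
{ destruct (Req_dec (Im w) 0) as [E|N].
  - specialize (H E). lra.
  - assert (0 < Im w ^ 2) by (apply pow2_gt_0; exact N). nra. }
assert (Hs : 0 < sqrt ((Cmod w + Re w) / 2)) by (apply sqrt_lt_R0; lra).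
assert (Hss : sqrt ((Cmod w + Re w) / 2) * sqrt ((Cmod w + Re w) / 2) = (Cmod w + Re w) / 2)
  by (apply sqrt_sqrt; lra).
unfold Csqrt. set (s := sqrt ((Cmod w + Re w) / 2)) in *.
split; [exact Hs|].
rewrite (surjective_pairing w) at 3. unfold Cmult; simpl. f_equal.
- replace (Im w / (2 * s) * (Im w / (2 * s))) with (Im w ^ 2 / (4 * (s * s))) by (field; lra).
  replace (Im w ^ 2) with ((Cmod w - Re w) * (Cmod w + Re w)) by (simpl in *; lra).
  rewrite Hss. change (fst w) with (Re w). field. lra.
- change (snd w) with (Im w). field. lra.
Qed.

(** [G w - G z] is [u w - u z] divided by [G w + G z], and the positive real parts keep
    [G w + G z] away from 0; continuity of [G] comes out of the same identity. *)
Lemma is_Cderive_sqrt_branch (G u : C -> C) (z l : C) (r : R) :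
  0 < r -> (forall w, Cmod (w - z) < r -> 0 < Re (G w) /\ (G w * G w)%C = u w) ->
  is_Cderive u z l -> is_Cderive G z (l / (RtoC 2 * G z))%C.
Proof.
intros Hr HG Hu.
destruct (HG z ltac:(rewrite Cmod_self; lra)) as [Hz1 Hz2].
set (s := Re (G z)) in *.
assert (Hlow : forall w, Cmod (w - z) < r -> s <= Cmod (G w + G z)).
{ intros w Hw. destruct (HG w Hw) as [Hw1 _].
  eapply Rle_trans; [|apply Re_le_Cmod]. eapply Rle_trans; [|apply Rle_abs].
  unfold s. change (Re (G z) <= Re (G w) + Re (G z)). lra. }
assert (Hdiff : forall w, Cmod (w - z) < r -> ((G w - G z) * (G w + G z))%C = (u w - u z)%C).
{ intros w Hw. rewrite <- Hz2, <- (proj2 (HG w Hw)). ring. }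
destruct (is_Cderive_lipschitz _ _ _ Hu) as [d1 [Hd1 H1]].
set (A := Cmod l + 1) in *.
assert (HA : 0 < A) by (unfold A; generalize (Cmod_ge_0 l); lra).
assert (Hzn : G z <> 0%C).
{ intros E. unfold s in Hz1. rewrite E in Hz1. simpl in Hz1. lra. }
assert (HGl : forall w, Cmod (w - z) < r -> Cmod (w - z) < d1 ->
  Cmod (G w - G z) <= A / s * Cmod (w - z)).
{ intros w Hw Hwd. specialize (H1 w Hwd).
  rewrite <- Hdiff, Cmod_mult in H1 by exact Hw.
  assert (Hl := Hlow w Hw). assert (Hg := Cmod_ge_0 (G w - G z)).
  apply Rmult_le_reg_r with s; [exact Hz1|].
  replace (A / s * Cmod (w - z) * s) with (A * Cmod (w - z)) by (field; lra). nra. }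
apply is_Cderive_eps; intros eps Heps.
destruct (proj1 (is_Cderive_eps _ _ _) Hu (eps * s) ltac:(apply Rmult_lt_0_compat; lra))
  as [d2 [Hd2 H2]].
set (B := (A / s) * (A / s)).
assert (HAs : 0 < A / s) by (apply Rdiv_lt_0_compat; lra).
assert (HB : 0 < B) by (apply Rmult_lt_0_compat; lra).
exists (Rmin (Rmin r d1) (Rmin d2 (eps * s / B))); split.
{ repeat apply Rmin_pos; try lra. apply Rdiv_lt_0_compat; [apply Rmult_lt_0_compat|]; lra. }
intros w Hw.
assert (Hm1 := Rmin_l (Rmin r d1) (Rmin d2 (eps * s / B))).
assert (Hm2 := Rmin_r (Rmin r d1) (Rmin d2 (eps * s / B))).
assert (Hm3 := Rmin_l r d1). assert (Hm4 := Rmin_r r d1).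
assert (Hm5 := Rmin_l d2 (eps * s / B)). assert (Hm6 := Rmin_r d2 (eps * s / B)).
specialize (HGl w ltac:(lra) ltac:(lra)). specialize (H2 w ltac:(lra)).
specialize (Hdiff w ltac:(lra)).
assert (Hwb : Cmod (w - z) < eps * s / B) by lra.
apply Rlt_div_r in Hwb; [|lra].
set (x := Cmod (w - z)) in *. assert (Hx : 0 <= x) by apply Cmod_ge_0.
(* [2 G z (G w - G z) = u w - u z - (G w - G z)^2], with a quadratic last term *)
replace (G w - G z - l / (RtoC 2 * G z) * (w - z))%C with
  ((((G w - G z) * (G w + G z) - l * (w - z)) - (G w - G z) * (G w - G z)) / (RtoC 2 * G z))%C.
2:{ field. exact Hzn. }
assert (H2n : RtoC 2 <> 0%C) by (intros E; apply RtoC_inj in E; lra).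
rewrite Cmod_div by (apply Cmult_neq_0; auto).
assert (Hsz : s <= Cmod (G z)) by (eapply Rle_trans; [apply Rle_abs | apply Re_le_Cmod]).
rewrite Cmod_mult, Cmod_R, (Rabs_pos_eq 2) by lra.
apply Rle_div_l; [lra|].
eapply Rle_trans; [apply Cmod_minus_le|].
rewrite Hdiff, Cmod_mult.
assert (E2 : Cmod (G w - G z) * Cmod (G w - G z) <= (A / s * x) * (A / s * x)).
{ apply Rmult_le_compat; try apply Cmod_ge_0; exact HGl. }
replace (A / s * x * (A / s * x)) with (x * B * x) in E2 by (unfold B; field; lra).
assert (E3 : x * B * x <= eps * s * x) by (apply Rmult_le_compat_r; lra).
assert (E4 : eps * x * s <= eps * x * Cmod (G z)).
{ apply Rmult_le_compat_l; [apply Rmult_le_pos|]; lra. }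
lra.
Qed.

(** Points of the range on both sides of an omitted [w] on a horizontal line would disconnect
    the intersection with this line. *)
Lemma convex_horizontal_omitted (Omega : C -> Prop) (w : C) :
  convex_in_horizontal_direction Omega -> ~ Omega w ->
  (forall z, Omega z -> Im z = Im w -> Re z < Re w) \/
  (forall z, Omega z -> Im z = Im w -> Re w < Re z).
Proof.
intros Hc Hw.
assert (HU : forall (D : R -> Prop), Hierarchy.open D -> Hierarchy.open (fun z : C => D (Re z))).
{ intros D HD. apply (open_comp (fun z : C => Re z) D); [|exact HD].
  intros x _. apply continuous_fst. }
destruct (classic (exists z, Omega z /\ Im z = Im w /\ Re w < Re z)) as [[z1 Hz1]|N1].
2:{ left. intros z Hz Hi. destruct (Rtotal_order (Re z) (Re w)) as [L|[E|L]].
  - exact L.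
  - exfalso. apply Hw. replace w with z; [exact Hz|].
    destruct z, w; unfold Re, Im in *; simpl in *; congruence.
  - exfalso; apply N1; now exists z. }
destruct (classic (exists z, Omega z /\ Im z = Im w /\ Re z < Re w)) as [[z2 Hz2]|N2].
2:{ right. intros z Hz Hi. destruct (Rtotal_order (Re z) (Re w)) as [L|[E|L]].
  - exfalso; apply N2; now exists z.
  - exfalso. apply Hw. replace w with z; [exact Hz|].
    destruct z, w; unfold Re, Im in *; simpl in *; congruence.
  - exact L. }
exfalso. apply (Hc (Im w)).
exists (fun z => Re w < Re z), (fun z => Re z < Re w).
repeat split.
- apply (HU (fun x => Re w < x)), open_gt.
- apply (HU (fun x => x < Re w)), open_lt.
- intros z [Hz Hi]. destruct (Rtotal_order (Re z) (Re w)) as [L|[E|L]]; auto.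
  exfalso. apply Hw. replace w with z; [exact Hz|].
  destruct z, w; unfold Re, Im in *; simpl in *; congruence.
- intros z [_ [H1 H2]]. lra.
- exists z1; tauto.
- exists z2; tauto.
Qed.

(** With [e (w - f) = G^2] and [rho] the distance from [b] to the circle, [rho |G'| <= 2 |G|] and
    [rho^2 |G''| <= 8 |G|].  The omitted value satisfies [|G|^2 <= 4 rho |f' b| = 8 rho |G| |G'|],
    that is [|G| <= 8 rho |G'|], whence [rho |G''| <= 64 |G'|].  As [f'' / f' = G' / G + G'' / G'],
    the constant is [2 + 64]. *)
Lemma pre_schwarzian_bound (f : C -> C) (b : C) :
  analytic_in_disk f -> univalent_in_disk f ->
  convex_in_horizontal_direction (range_of_disk f) -> disk b ->
  (1 - Cmod b) * Cmod (C_derive (C_derive f) b) <= 66 * Cmod (C_derive f b).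
Proof.
intros Hf Hi Hc Hb.
destruct (omitted_value_near f b Hf Hi Hb) as [w [Hw1 Hw2]].
assert (Hs : exists e : R, e * e = 1 /\ forall z, disk z ->
   Im (RtoC e * (w - f z))%C = 0 -> 0 < Re (RtoC e * (w - f z))%C).
{ assert (Hexp : forall e z, Re (RtoC e * (w - f z))%C = e * (Re w - Re (f z)) /\
     Im (RtoC e * (w - f z))%C = e * (Im w - Im (f z))).
  { intros e z. unfold Re, Im, RtoC, Cmult, Cminus, Cplus, Copp; simpl; split; ring. }
  destruct (convex_horizontal_omitted (range_of_disk f) w Hc) as [H|H].
  - intros [z [Hz E]]. now apply (Hw2 z).
  - exists 1; split; [ring|]. intros z Hz. destruct (Hexp 1 z) as [-> ->]. intros E.
    assert (HH := H (f z) (ex_intro _ z (conj Hz eq_refl)) ltac:(lra)). lra.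
  - exists (-1); split; [ring|]. intros z Hz. destruct (Hexp (-1) z) as [-> ->]. intros E.
    assert (HH := H (f z) (ex_intro _ z (conj Hz eq_refl)) ltac:(lra)). lra. }
destruct Hs as [e [He Hslit]].
(* [e] selects the side of [w] on which the horizontal ray is omitted. *)
set (u := fun z => (RtoC e * (w - f z))%C).
set (G := fun z => Csqrt (u z)).
assert (HG : forall z, disk z -> 0 < Re (G z) /\ (G z * G z)%C = u z).
{ intros z Hz. apply Csqrt_spec. now apply Hslit. }
assert (Hee : (RtoC e * RtoC e)%C = RtoC 1) by (rewrite <- RtoC_mult, He; reflexivity).
assert (Hdisk : forall z, disk z -> 0 < 1 - Cmod z) by (unfold disk; intros; lra).
assert (HGd : forall z, disk z -> is_Cderive G z (- RtoC e * C_derive f z / (RtoC 2 * G z))%C).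
{ intros z Hz. apply (is_Cderive_sqrt_branch G u z _ (1 - Cmod z)); [now apply Hdisk | |].
  - intros y Hy. apply HG. now apply (in_sub_ball y z).
  - eapply is_Cderive_eq.
    + apply (is_Cderive_mult (fun _ => RtoC e) (fun z => w - f z)%C); [apply is_Cderive_const|].
      apply is_Cderive_minus; [apply is_Cderive_const | apply C_derive_is, Hf, Hz].
    + ring. }
assert (HGa : analytic_in_disk G) by (intros z Hz; eexists; now apply HGd).
assert (HG' := analytic_derive G HGa).
assert (HGn : forall z, disk z -> G z <> 0%C).
{ intros z Hz E. destruct (HG z Hz) as [H _]. rewrite E in H. simpl in H; lra. }
assert (H2n : RtoC 2 <> 0%C) by (intros E; apply RtoC_inj in E; lra).
assert (Hf1 : forall z, disk z -> C_derive f z = (- (RtoC 2 * RtoC e) * (G z * C_derive G z))%C).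
{ intros z Hz. rewrite (is_C_derive_unique _ _ _ (HGd z Hz)).
  transitivity ((RtoC e * RtoC e) * C_derive f z)%C; [rewrite Hee; ring|].
  field. now apply HGn. }
assert (Hf2 : C_derive (C_derive f) b =
  (- (RtoC 2 * RtoC e) * (C_derive G b * C_derive G b + G b * C_derive (C_derive G) b))%C).
{ apply is_C_derive_unique.
  apply (is_Cderive_ext_ball (fun z => - (RtoC 2 * RtoC e) * (G z * C_derive G z))%C _ b _ (1 - Cmod b)).
  - now apply Hdisk.
  - intros z Hz. symmetry. apply Hf1. now apply (in_sub_ball z b).
  - eapply is_Cderive_eq.
    + apply (is_Cderive_mult (fun _ => - (RtoC 2 * RtoC e))%C (fun z => G z * C_derive G z)%C);
        [apply is_Cderive_const|].
      apply (is_Cderive_mult G (C_derive G)); apply C_derive_is; [now apply HGa | now apply HG'].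
    + ring. }
set (rho := 1 - Cmod b) in *. assert (HR : 0 < rho) by now apply Hdisk.
assert (Hpos : forall z, Cmod (z - b) < rho -> 0 <= Re (G z)).
{ intros z Hz. apply Rlt_le, HG. now apply (in_sub_ball z b). }
assert (K1 := half_plane_derivative G b rho HR (analytic_sub_ball G b HGa) Hpos).
assert (K2 := half_plane_second_derivative G b rho HR (analytic_sub_ball G b HGa) Hpos).
assert (K3 : Re (G b) <= Cmod (G b)) by (eapply Rle_trans; [apply Rle_abs | apply Re_le_Cmod]).
assert (Hae : Rabs e = 1).
{ assert (H : Rabs e * Rabs e = 1) by (rewrite <- Rabs_mult, He, Rabs_R1; reflexivity).
  generalize (Rabs_pos e); nra. }
assert (K4 : Cmod (G b) * Cmod (G b) = Cmod (w - f b)).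
{ rewrite <- Cmod_mult, (proj2 (HG b Hb)). unfold u. rewrite Cmod_mult, Cmod_R, Hae. ring. }
assert (Hce : Cmod (- (RtoC 2 * RtoC e)) = 2).
{ rewrite Cmod_opp, Cmod_mult, !Cmod_R, Hae, Rabs_pos_eq; lra. }
rewrite <- K4 in Hw1.
rewrite Hf2, (Hf1 b Hb), !(Cmod_mult (- (RtoC 2 * RtoC e))), Hce.
rewrite (Hf1 b Hb), Cmod_mult, Hce in Hw1.
rewrite Cmod_mult in *.
assert (T := Cmod_triangle (C_derive G b * C_derive G b) (G b * C_derive (C_derive G) b)).
rewrite !Cmod_mult in T.
assert (Hg0 : 0 < Cmod (G b)) by (apply Cmod_gt_0, HGn, Hb).
set (g0 := Cmod (G b)) in *. set (g1 := Cmod (C_derive G b)) in *.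
set (g2 := Cmod (C_derive (C_derive G) b)) in *.
assert (Hg1 : 0 <= g1) by apply Cmod_ge_0. assert (Hg2 : 0 <= g2) by apply Cmod_ge_0.
assert (K5 : g0 <= 8 * rho * g1) by (apply Rmult_le_reg_r with g0; [exact Hg0 | lra]).
assert (K6 : rho * g2 <= 64 * g1).
{ apply Rmult_le_reg_l with rho; [exact HR|].
  apply Rle_trans with (8 * Re (G b)); [replace (rho * (rho * g2)) with (rho ^ 2 * g2) by ring; exact K2 | lra]. }
assert (K7 : rho * g1 * g1 <= 2 * g0 * g1) by (apply Rmult_le_compat_r; lra).
assert (K8 : g0 * (rho * g2) <= g0 * (64 * g1)) by (apply Rmult_le_compat_l; lra).
assert (K9 : rho * Cmod (C_derive G b * C_derive G b + G b * C_derive (C_derive G) b)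
  <= rho * (g1 * g1 + g0 * g2)) by (apply Rmult_le_compat_l; lra).
lra.
Qed.
(** * Wirtinger calculus *)

(** Differentiation by components, the form in which the partial derivatives [partial_x] and
    [partial_y] are defined. *)
Definition is_derive_components (c : R -> C) (t : R) (l : C) : Prop :=
  is_derive (fun s => Re (c s)) t (Re l) /\ is_derive (fun s => Im (c s)) t (Im l).

(** [A] and [B] are the derivatives with respect to [z] and [conj z], recorded through the
    partial derivatives [A + B] and [Ci (A - B)].  Keeping [B] along makes the product and
    conjugation rules compositional. *)
Definition has_wirtinger (F : C -> C) (z A B : C) : Prop :=
  is_derive_components (fun t => F (t, Im z)) (Re z) (A + B)%C /\
  is_derive_components (fun t => F (Re z, t)) (Im z) (Ci * (A - B))%C.

Lemma has_wirtinger_unique (F : C -> C) (z A B : C) :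
  has_wirtinger F z A B -> wirtinger F z = A.
Proof.
intros [[H1 H2] [H3 H4]]. unfold wirtinger.
assert (Ex : partial_x F z = (A + B)%C).
{ rewrite (surjective_pairing (A + B)%C).
  exact (f_equal2 pair (is_derive_unique _ _ _ H1) (is_derive_unique _ _ _ H2)). }
assert (Ey : partial_y F z = (Ci * (A - B))%C).
{ rewrite (surjective_pairing (Ci * (A - B))%C).
  exact (f_equal2 pair (is_derive_unique _ _ _ H3) (is_derive_unique _ _ _ H4)). }
rewrite Ex, Ey.
transitivity (/ RtoC 2 * ((A + B) - (Ci * Ci) * (A - B)))%C; [ring|].
replace (Ci * Ci)%C with (RtoC (-1)) by (unfold Ci, Cmult, RtoC; simpl; f_equal; ring).
replace (RtoC (-1)) with (- RtoC 1)%C by (unfold Copp, RtoC; simpl; f_equal; ring).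
field.
Qed.

Lemma has_wirtinger_eq (F : C -> C) (z A B A' B' : C) :
  has_wirtinger F z A B -> A = A' -> B = B' -> has_wirtinger F z A' B'.
Proof. now intros H <- <-. Qed.

Lemma has_wirtinger_ext (F G : C -> C) (z A B : C) (r : R) :
  0 < r -> (forall w, Cmod (w - z) < r -> F w = G w) ->
  has_wirtinger F z A B -> has_wirtinger G z A B.
Proof.
intros Hr He.
assert (Hx : locally (Re z) (fun t => F (t, Im z) = G (t, Im z))).
{ exists (mkposreal r Hr). intros t Ht. apply He.
  replace ((t, Im z) - z)%C with (RtoC (t - Re z)).
  - rewrite Cmod_R. exact Ht.
  - unfold RtoC, Cminus, Cplus, Copp, Re, Im; simpl; f_equal; ring. }
assert (Hy : locally (Im z) (fun t => F (Re z, t) = G (Re z, t))).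
{ exists (mkposreal r Hr). intros t Ht. apply He.
  replace ((Re z, t) - z)%C with (RtoC (t - Im z) * Ci)%C.
  - rewrite Cmod_mult, Cmod_Ci, Cmod_R, Rmult_1_r. exact Ht.
  - unfold RtoC, Ci, Cminus, Cplus, Cmult, Copp, Re, Im; simpl; f_equal; ring. }
intros [[H1 H2] [H3 H4]]; repeat split;
  (eapply is_derive_ext_loc; [|eassumption]);
  (eapply filter_imp; [|eassumption]); simpl; intros t ->; reflexivity.
Qed.

Lemma is_derive_components_mult (c d : R -> C) (t : R) (l m : C) :
  is_derive_components c t l -> is_derive_components d t m ->
  is_derive_components (fun s => c s * d s)%C t (l * d t + c t * m)%C.
Proof.
intros [H1 H2] [H3 H4]; split.
- apply is_derive_ext with (fun s => Re (c s) * Re (d s) - Im (c s) * Im (d s)); [reflexivity|].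
  replace (Re (l * d t + c t * m)%C) with
    ((Re l * Re (d t) + Re (c t) * Re m) - (Im l * Im (d t) + Im (c t) * Im m))
    by (unfold Re, Im, Cmult, Cplus; simpl; ring).
  apply (is_derive_minus (V := R_NormedModule) (fun s => Re (c s) * Re (d s)) (fun s => Im (c s) * Im (d s))).
  + now apply (is_derive_mult (fun s => Re (c s)) (fun s => Re (d s)) t _ _ H1 H3 Rmult_comm).
  + now apply (is_derive_mult (fun s => Im (c s)) (fun s => Im (d s)) t _ _ H2 H4 Rmult_comm).
- apply is_derive_ext with (fun s => Re (c s) * Im (d s) + Im (c s) * Re (d s)); [reflexivity|].
  replace (Im (l * d t + c t * m)%C) with
    ((Re l * Im (d t) + Re (c t) * Im m) + (Im l * Re (d t) + Im (c t) * Re m))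
    by (unfold Re, Im, Cmult, Cplus; simpl; ring).
  apply (is_derive_plus (V := R_NormedModule) (fun s => Re (c s) * Im (d s)) (fun s => Im (c s) * Re (d s))).
  + now apply (is_derive_mult (fun s => Re (c s)) (fun s => Im (d s)) t _ _ H1 H4 Rmult_comm).
  + now apply (is_derive_mult (fun s => Im (c s)) (fun s => Re (d s)) t _ _ H2 H3 Rmult_comm).
Qed.

Lemma is_derive_components_plus (c d : R -> C) (t : R) (l m : C) :
  is_derive_components c t l -> is_derive_components d t m ->
  is_derive_components (fun s => c s + d s)%C t (l + m)%C.
Proof.
intros [H1 H2] [H3 H4]; split.
- now apply (is_derive_plus (V := R_NormedModule) (fun s => Re (c s)) (fun s => Re (d s))).
- now apply (is_derive_plus (V := R_NormedModule) (fun s => Im (c s)) (fun s => Im (d s))).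
Qed.

Lemma is_derive_components_holo (f : C -> C) (c : R -> C) (a v l : C) (t : R) :
  (forall s, c s = (a + RtoC s * v)%C) -> is_Cderive f (c t) l ->
  is_derive_components (fun s => f (c s)) t (l * v)%C.
Proof.
intros Hc Hl. rewrite Hc in Hl. split.
- apply is_derive_ext with (fun s => Re (RtoC 1 * f (a + RtoC s * v))%C).
  { intros s. rewrite Hc. f_equal; ring. }
  replace (l * v)%C with (RtoC 1 * l * v)%C by ring. now apply is_derive_Re_line.
- apply is_derive_ext with (fun s => Re (- Ci * f (a + RtoC s * v))%C).
  { intros s. rewrite Hc. unfold Re, Im, Ci, Cmult, Copp; simpl; ring. }
  replace (Im (l * v)%C) with (Re (- Ci * l * v)%C)
    by (unfold Re, Im, Ci, Cmult, Copp; simpl; ring).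
  now apply is_derive_Re_line.
Qed.

Lemma has_wirtinger_holo (f : C -> C) (z l : C) :
  is_Cderive f z l -> has_wirtinger f z l (RtoC 0).
Proof.
intros Hl. split.
- replace (l + RtoC 0)%C with (l * RtoC 1)%C by ring.
  apply (is_derive_components_holo f (fun t => (t, Im z)) (0, Im z) (RtoC 1)).
  + intros s. unfold RtoC, Cplus, Cmult; simpl; f_equal; ring.
  + rewrite (surjective_pairing z) in Hl. exact Hl.
- replace (Ci * (l - RtoC 0))%C with (l * Ci)%C by ring.
  apply (is_derive_components_holo f (fun t => (Re z, t)) (RtoC (Re z)) Ci).
  + intros s. unfold RtoC, Ci, Cplus, Cmult; simpl; f_equal; ring.
  + rewrite (surjective_pairing z) in Hl. exact Hl.
Qed.

Lemma has_wirtinger_plus (F G : C -> C) (z A B A' B' : C) :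
  has_wirtinger F z A B -> has_wirtinger G z A' B' ->
  has_wirtinger (fun w => F w + G w)%C z (A + A')%C (B + B')%C.
Proof.
intros [H1 H2] [H3 H4]; split.
- replace (A + A' + (B + B'))%C with ((A + B) + (A' + B'))%C by ring.
  now apply is_derive_components_plus.
- replace (Ci * (A + A' - (B + B')))%C with (Ci * (A - B) + Ci * (A' - B'))%C by ring.
  now apply is_derive_components_plus.
Qed.

Lemma has_wirtinger_mult (F G : C -> C) (z A B A' B' : C) :
  has_wirtinger F z A B -> has_wirtinger G z A' B' ->
  has_wirtinger (fun w => F w * G w)%C z (A * G z + F z * A')%C (B * G z + F z * B')%C.
Proof.
assert (Ez : (Re z, Im z) = z) by (symmetry; apply surjective_pairing).
intros [H1 H2] [H3 H4]; split.
- assert (H := is_derive_components_mult _ _ _ _ _ H1 H3). cbv beta in H. rewrite Ez in H.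
  replace (A * G z + F z * A' + (B * G z + F z * B'))%C
    with ((A + B) * G z + F z * (A' + B'))%C by ring. exact H.
- assert (H := is_derive_components_mult _ _ _ _ _ H2 H4). cbv beta in H. rewrite Ez in H.
  replace (Ci * (A * G z + F z * A' - (B * G z + F z * B')))%C
    with (Ci * (A - B) * G z + F z * (Ci * (A' - B')))%C by ring. exact H.
Qed.

Lemma has_wirtinger_conj (F : C -> C) (z A B : C) :
  has_wirtinger F z A B -> has_wirtinger (fun w => Cconj (F w)) z (Cconj B) (Cconj A).
Proof.
assert (Hc : forall c t l, is_derive_components c t l ->
  is_derive_components (fun s => Cconj (c s)) t (Cconj l)).
{ intros c t l [H1 H2]; split; [exact H1|].
  exact (is_derive_opp (V := R_NormedModule) (fun s => Im (c s)) t _ H2). }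
intros [H1 H2]; split.
- replace (Cconj B + Cconj A)%C with (Cconj (A + B))
    by (unfold Cconj, Cplus; simpl; f_equal; ring).
  now apply Hc in H1.
- replace (Ci * (Cconj B - Cconj A))%C with (Cconj (Ci * (A - B)))
    by (unfold Cconj, Ci, Cmult, Cminus, Cplus, Copp; simpl; f_equal; ring).
  now apply Hc in H2.
Qed.

(** Along each axis the derivative of a real-valued function is real, so the real chain rule
    multiplies both components by the same factor. *)
Lemma has_wirtinger_real_comp (phi : R -> R) (u : C -> R) (z A B : C) (l : R) :
  is_derive phi (u z) l -> has_wirtinger (fun w => RtoC (u w)) z A B ->
  has_wirtinger (fun w => RtoC (phi (u w))) z (RtoC l * A)%C (RtoC l * B)%C.
Proof.
intros Hl.
assert (Ez : (Re z, Im z) = z) by (symmetry; apply surjective_pairing).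
assert (Hc : forall (c : R -> R) t m, is_derive phi (c t) l ->
  is_derive_components (fun s => RtoC (c s)) t m ->
  is_derive_components (fun s => RtoC (phi (c s))) t (RtoC l * m)%C).
{ intros c t m Hlt [H1 H2].
  assert (Hm : Im m = 0).
  { assert (H0 := is_derive_const (V := R_NormedModule) 0 t).
    rewrite <- (is_derive_unique _ _ _ H2). now apply is_derive_unique. }
  split.
  - replace (Re (RtoC l * m)%C) with (Re m * l)
      by (unfold Re, Im, RtoC, Cmult in *; simpl; rewrite Hm; ring).
    apply (is_derive_comp (V := R_NormedModule) phi c); [exact Hlt | exact H1].
  - replace (Im (RtoC l * m)%C) with 0
      by (unfold Re, Im, RtoC, Cmult in *; simpl; rewrite Hm; ring).
    exact (is_derive_const (V := R_NormedModule) 0 t). }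
intros [H1 H2]; split.
- replace (RtoC l * A + RtoC l * B)%C with (RtoC l * (A + B))%C by ring.
  apply (Hc (fun t => u (t, Im z))); [now rewrite Ez | exact H1].
- replace (Ci * (RtoC l * A - RtoC l * B))%C with (RtoC l * (Ci * (A - B)))%C by ring.
  apply (Hc (fun t => u (Re z, t))); [now rewrite Ez | exact H2].
Qed.

Definition norm2 (f : C -> C) (w : C) : R := Cmod (f w) ^ 2.

Lemma has_wirtinger_norm2 (f : C -> C) (z l : C) :
  is_Cderive f z l ->
  has_wirtinger (fun w => RtoC (norm2 f w)) z (l * Cconj (f z))%C (f z * Cconj l)%C.
Proof.
intros Hl.
assert (H := has_wirtinger_holo f z l Hl).
assert (HH := has_wirtinger_mult _ _ _ _ _ _ _ H (has_wirtinger_conj _ _ _ _ H)).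
apply (has_wirtinger_ext (fun w => f w * Cconj (f w))%C _ z _ _ 1 Rlt_0_1).
{ intros w _. apply Cconj_mult_self. }
apply (has_wirtinger_eq _ _ _ _ _ _ HH).
- replace (Cconj (RtoC 0)) with (RtoC 0) by (unfold Cconj, RtoC; simpl; f_equal; ring). ring.
- ring.
Qed.

Lemma is_derive_ln_pos (x : R) : 0 < x -> is_derive ln x (/ x).
Proof. intros Hx. apply is_derive_Reals, derivable_pt_lim_ln, Hx. Qed.

Lemma is_derive_inv_pos (x : R) : 0 < x -> is_derive Rinv x (- / x ^ 2).
Proof.
intros Hx. replace (- / x ^ 2) with (- 1 / x ^ 2) by (field; lra).
apply (is_derive_inv (fun x => x)); [apply (is_derive_id (K := R_AbsRing)) | lra].
Qed.

(** * The Schwarzian of a harmonic shear *)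

(** The function [conj q / (1 + |q|^2)]; times [q'] it is the [z]-derivative of
    [ln (1 + |q|^2)]. *)
Definition dilatation_weight (q : C -> C) (w : C) : C :=
  (RtoC (/ (1 + norm2 q w)) * Cconj (q w))%C.

Lemma norm2_ge_0 (f : C -> C) (w : C) : 0 <= norm2 f w.
Proof. apply pow2_ge_0. Qed.

Lemma has_wirtinger_one_plus_norm2 (q : C -> C) (z l : C) :
  is_Cderive q z l ->
  has_wirtinger (fun w => RtoC (1 + norm2 q w)) z (l * Cconj (q z))%C (q z * Cconj l)%C.
Proof.
intros Hl.
apply (has_wirtinger_ext (fun w => RtoC 1 + RtoC (norm2 q w))%C _ z _ _ 1 Rlt_0_1).
{ intros w _. now rewrite RtoC_plus. }
eapply has_wirtinger_eq.
- apply (has_wirtinger_plus (fun _ => RtoC 1)).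
  + apply has_wirtinger_holo, is_Cderive_const.
  + exact (has_wirtinger_norm2 q z l Hl).
- ring.
- ring.
Qed.

(** On the disk [sigma = ln |h'|^2 / 2 + ln (1 + |q|^2)], because [|g'| = |q|^2 |h'|]. *)
Lemma wirtinger_sigma (h g q : C -> C) (z : C) :
  analytic_in_disk h -> analytic_in_disk q -> disk z ->
  (forall w, disk w -> C_derive g w = (q w ^ 2 * C_derive h w)%C) ->
  (forall w, disk w -> C_derive h w <> 0%C) ->
  wirtinger (sigma h g) z =
  (RtoC (/ 2) * (C_derive (C_derive h) z / C_derive h z) + C_derive q z * dilatation_weight q z)%C.
Proof.
intros Hh Hq Hz Hg Hn.
assert (Hh' := analytic_derive h Hh).
set (H := C_derive h) in *.
assert (HzH : is_Cderive H z (C_derive H z)) by apply C_derive_is, Hh', Hz.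
assert (Hzq : is_Cderive q z (C_derive q z)) by apply C_derive_is, Hq, Hz.
assert (HN : 0 < norm2 H z) by (apply pow_lt, Cmod_gt_0, Hn, Hz).
assert (HQ := norm2_ge_0 q z).
eapply has_wirtinger_unique.
apply (has_wirtinger_ext (fun w => RtoC (/ 2) * RtoC (ln (norm2 H w)) + RtoC (ln (1 + norm2 q w)))%C
  _ z _ _ (1 - Cmod z)).
- unfold disk in Hz; lra.
- intros w Hw. apply in_sub_ball in Hw.
  unfold sigma. rewrite <- RtoC_mult, <- RtoC_plus. f_equal.
  rewrite (Hg w Hw), Cmod_mult, Cmod_pow. fold H. unfold norm2.
  assert (HHw : 0 < Cmod (H w)) by (apply Cmod_gt_0, Hn, Hw).
  replace (Cmod (H w) + Cmod (q w) ^ 2 * Cmod (H w))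
    with (Cmod (H w) * (1 + Cmod (q w) ^ 2)) by ring.
  rewrite ln_mult; [|exact HHw | generalize (pow2_ge_0 (Cmod (q w))); lra].
  f_equal. simpl. rewrite Rmult_1_r, ln_mult by exact HHw. field.
- eapply has_wirtinger_eq.
  + apply (has_wirtinger_plus (fun w => RtoC (/ 2) * RtoC (ln (norm2 H w)))%C
      (fun w => RtoC (ln (1 + norm2 q w)))).
    * apply (has_wirtinger_mult (fun _ => RtoC (/ 2)) (fun w => RtoC (ln (norm2 H w)))).
      -- apply has_wirtinger_holo, is_Cderive_const.
      -- apply (has_wirtinger_real_comp ln (norm2 H)); [now apply is_derive_ln_pos|].
         exact (has_wirtinger_norm2 H z _ HzH).
    * apply (has_wirtinger_real_comp ln (fun w => 1 + norm2 q w)); [apply is_derive_ln_pos; lra|].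
      exact (has_wirtinger_one_plus_norm2 q z _ Hzq).
  + unfold dilatation_weight.
    assert (E : (RtoC (/ norm2 H z) * (C_derive H z * Cconj (H z)))%C = (C_derive H z / H z)%C).
    { rewrite RtoC_inv by lra. unfold norm2. rewrite <- Cconj_mult_self.
      field. split; [now apply Hn|]. intros E0.
      assert (Hc := Cmod_conj (H z)). rewrite E0, Cmod_0 in Hc.
      apply (Hn z Hz). apply Cmod_eq_0. now symmetry. }
    rewrite E. ring.
  + reflexivity.
Qed.

(** The [z]-derivative does not fall on [conj q], so only the factor [1 / (1 + |q|^2)]
    contributes. *)
Lemma has_wirtinger_dilatation_weight (q : C -> C) (z l : C) :
  is_Cderive q z l ->
  exists B, has_wirtinger (dilatation_weight q) z (- (l * (dilatation_weight q z * dilatation_weight q z)))%C B.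
Proof.
intros Hl. assert (HQ := norm2_ge_0 q z). eexists. eapply has_wirtinger_eq.
- apply (has_wirtinger_mult (fun w => RtoC (/ (1 + norm2 q w))) (fun w => Cconj (q w))).
  + apply (has_wirtinger_real_comp Rinv (fun w => 1 + norm2 q w)).
    * apply is_derive_inv_pos; lra.
    * exact (has_wirtinger_one_plus_norm2 q z l Hl).
  + apply has_wirtinger_conj. exact (has_wirtinger_holo q z l Hl).
- unfold dilatation_weight.
  replace (Cconj (RtoC 0)) with (RtoC 0) by (unfold Cconj, RtoC; simpl; f_equal; ring).
  replace (RtoC (- / (1 + norm2 q z) ^ 2))
    with (- (RtoC (/ (1 + norm2 q z)) * RtoC (/ (1 + norm2 q z))))%C.
  + ring.
  + rewrite <- RtoC_mult, <- RtoC_opp. f_equal. field. lra.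
- reflexivity.
Qed.

Lemma schwarzian_formula (h g q : C -> C) (z : C) :
  analytic_in_disk h -> analytic_in_disk q -> disk z ->
  (forall w, disk w -> C_derive g w = (q w ^ 2 * C_derive h w)%C) ->
  (forall w, disk w -> C_derive h w <> 0%C) ->
  let P := fun w => (C_derive (C_derive h) w / C_derive h w)%C in
  let s := dilatation_weight q z in
  schwarzian h g z =
  (C_derive P z - P z * P z / RtoC 2 +
   RtoC 2 * s * (C_derive (C_derive q) z - C_derive q z * P z)
   - RtoC 4 * (C_derive q z * C_derive q z * (s * s)))%C.
Proof.
intros Hh Hq Hz Hg Hn P s.
assert (Hh' := analytic_derive h Hh). assert (Hh'' := analytic_derive _ Hh').
assert (Hq' := analytic_derive q Hq).
assert (HP : is_Cderive P z (C_derive P z)).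
{ apply C_derive_is. eexists. apply (is_Cderive_div (C_derive (C_derive h)) (C_derive h)).
  - now apply Hn.
  - apply C_derive_is, Hh'', Hz.
  - apply C_derive_is, Hh', Hz. }
unfold schwarzian.
destruct (has_wirtinger_dilatation_weight q z _ (C_derive_is q z (Hq z Hz))) as [B HB].
rewrite (has_wirtinger_unique (wirtinger (sigma h g)) z
  (RtoC (/ 2) * C_derive P z + (C_derive (C_derive q) z * s
     + C_derive q z * (- (C_derive q z * (s * s)))))%C
  (C_derive q z * B)%C).
- rewrite (wirtinger_sigma h g q z Hh Hq Hz Hg Hn). fold (P z). fold s.
  rewrite RtoC_inv by lra. field.
- apply (has_wirtinger_ext (fun w => RtoC (/ 2) * P w + C_derive q w * dilatation_weight q w)%C
    _ z _ _ (1 - Cmod z)).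
  + unfold disk in Hz; lra.
  + intros w Hw. symmetry. apply wirtinger_sigma; auto. now apply (in_sub_ball w z).
  + eapply has_wirtinger_eq.
    * apply (has_wirtinger_plus (fun w => RtoC (/ 2) * P w)%C).
      -- apply has_wirtinger_holo.
         apply (is_Cderive_mult (fun _ => RtoC (/ 2)) P); [apply is_Cderive_const | exact HP].
      -- apply (has_wirtinger_mult (C_derive q) (dilatation_weight q)); [|exact HB].
         apply has_wirtinger_holo, C_derive_is, Hq', Hz.
    * fold s. ring.
    * ring.
Qed.

Lemma Cmod_dilatation_weight (q : C -> C) (z : C) : Cmod (dilatation_weight q z) <= 1.
Proof.
unfold dilatation_weight, norm2. rewrite Cmod_mult, Cmod_conj, Cmod_R.
assert (H := Cmod_ge_0 (q z)). set (x := Cmod (q z)) in *.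
rewrite Rabs_pos_eq by (apply Rlt_le, Rinv_0_lt_compat; nra).
rewrite Rmult_comm. apply Rle_div_l; nra.
Qed.

(** Cauchy estimate on the circle of radius [(1 - |z|) / 2] about [z], on which the distance
    to the unit circle is at least half of [1 - |z|]. *)
Lemma derivative_growth (f : C -> C) (z : C) (K : R) :
  analytic_in_disk f -> (forall w, disk w -> (1 - Cmod w) * Cmod (f w) <= K) -> disk z ->
  (1 - Cmod z) ^ 2 * Cmod (C_derive f z) <= 4 * K.
Proof.
intros Hf HK Hz. set (d := 1 - Cmod z).
assert (Hd : 0 < d) by (unfold d, disk in *; lra).
assert (H : Cmod (C_derive f z) <= 2 * K / d / (d / 2)).
{ apply (cauchy_estimate f z _ d (d / 2)); [lra | now apply analytic_sub_ball | apply C_derive_is, Hf, Hz |].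
  intros w Hw.
  assert (Hdw : d / 2 <= 1 - Cmod w) by (generalize (Cmod_triangle_sub w z); unfold d in *; lra).
  assert (HKw := HK w ltac:(unfold disk; lra)).
  apply Rle_div_r; [exact Hd|]. assert (H0 := Cmod_ge_0 (f w)). nra. }
replace (4 * K) with (d ^ 2 * (2 * K / d / (d / 2))) by (field; lra).
apply Rmult_le_compat_l; [apply pow2_ge_0 | exact H].
Qed.

Lemma shear_derivative (phi q h g : C -> C) (z : C) :
  harmonic_shear phi q h g -> disk z ->
  C_derive phi z = ((RtoC 1 - q z ^ 2) * C_derive h z)%C.
Proof.
intros [Hh [Hg [Hphi Hdil]]] Hz.
transitivity (C_derive h z - C_derive g z)%C; [|rewrite (Hdil z Hz); ring].
apply is_C_derive_unique.
apply (is_Cderive_ext_ball (fun w => h w - g w)%C _ z _ (1 - Cmod z)).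
- unfold disk in Hz; lra.
- intros w Hw. apply Hphi. now apply (in_sub_ball w z).
- apply is_Cderive_minus; apply C_derive_is; [now apply Hh | now apply Hg].
Qed.

Lemma Cmod_one_minus_sqr (c : C) : 1 - Cmod c ^ 2 <= Cmod (RtoC 1 - c ^ 2).
Proof.
rewrite <- Cmod_pow. generalize (Cmod_triangle_sub (RtoC 1) (c ^ 2)%C).
rewrite Cmod_1; lra.
Qed.

(** Differentiating [phi' = (1 - q^2) h'] gives [h'' / h' = phi'' / phi' + 2 q q' / (1 - q^2)],
    whose terms contribute [66] and [2]. *)
Lemma shear_pre_schwarzian_bound (phi q h g : C -> C) (z : C) :
  analytic_in_disk phi -> univalent_in_disk phi ->
  convex_in_horizontal_direction (range_of_disk phi) -> analytic_in_disk q ->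
  (forall z : C, disk z -> Cmod (q z) < 1) -> harmonic_shear phi q h g -> disk z ->
  C_derive h z <> 0%C ->
  (1 - Cmod z) * Cmod (C_derive (C_derive h) z / C_derive h z) <= 68.
Proof.
intros Hphi Huni Hconv Hq Hqb Hs Hz Hn.
assert (Hd : 0 < 1 - Cmod z) by (unfold disk in Hz; lra).
assert (Hh : analytic_in_disk h) by apply Hs.
assert (Hh' := analytic_derive h Hh).
assert (Hsecond : C_derive (C_derive phi) z =
  ((RtoC 1 - q z ^ 2) * C_derive (C_derive h) z - RtoC 2 * q z * C_derive q z * C_derive h z)%C).
{ apply is_C_derive_unique.
  apply (is_Cderive_ext_ball (fun w => (RtoC 1 - q w * q w) * C_derive h w)%C _ z _ (1 - Cmod z) Hd).
  - intros w Hw. rewrite (shear_derivative phi q h g w Hs).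
    + ring.
    + now apply (in_sub_ball w z).
  - assert (Hl := C_derive_is q z (Hq z Hz)).
    eapply is_Cderive_eq.
    + apply (is_Cderive_mult (fun w => RtoC 1 - q w * q w)%C (C_derive h)).
      * apply is_Cderive_minus; [apply is_Cderive_const | exact (is_Cderive_mult q q z _ _ Hl Hl)].
      * apply C_derive_is, Hh', Hz.
    + ring. }
assert (K1 := pre_schwarzian_bound phi z Hphi Huni Hconv Hz).
assert (K2 := schwarz_pick q z Hq Hqb Hz).
rewrite (shear_derivative phi q h g z Hs Hz), Cmod_mult in K1.
assert (K3 := Cmod_one_minus_sqr (q z)).
assert (Hqz := Hqb z Hz). assert (Hq0 := Cmod_ge_0 (q z)).
set (m := Cmod (RtoC 1 - q z ^ 2)) in *.
assert (Hm : 0 < m) by nra.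
assert (K4 : m * Cmod (C_derive (C_derive h) z) <=
  Cmod (C_derive (C_derive phi) z) + 2 * Cmod (q z) * Cmod (C_derive q z) * Cmod (C_derive h z)).
{ unfold m. rewrite <- Cmod_mult.
  replace ((RtoC 1 - q z ^ 2) * C_derive (C_derive h) z)%C with
    (C_derive (C_derive phi) z + RtoC 2 * q z * C_derive q z * C_derive h z)%C
    by (rewrite Hsecond; ring).
  eapply Rle_trans; [apply Cmod_triangle|]. rewrite !Cmod_mult, Cmod_R, (Rabs_pos_eq 2); lra. }
rewrite Cmod_div by exact Hn. apply Cmod_gt_0 in Hn.
set (d := 1 - Cmod z) in *. set (h1 := Cmod (C_derive h z)) in *.
set (h2 := Cmod (C_derive (C_derive h) z)) in *.
set (q1 := Cmod (C_derive q z)) in *. set (q0 := Cmod (q z)) in *.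
assert (Hq1 : 0 <= q1) by apply Cmod_ge_0.
assert (K5 : d * q1 * h1 <= m * h1) by (apply Rmult_le_compat_r; lra).
assert (K6 : q0 * (d * q1 * h1) <= 1 * (m * h1)).
{ apply Rmult_le_compat; try lra. repeat apply Rmult_le_pos; lra. }
assert (K7 : d * (m * h2) <= d * (Cmod (C_derive (C_derive phi) z) + 2 * q0 * q1 * h1))
  by (apply Rmult_le_compat_l; lra).
replace (d * (h2 / h1)) with (d * h2 / h1) by (field; lra).
apply Rle_div_l; [exact Hn|].
apply Rmult_le_reg_l with m; [exact Hm|]. lra.
Qed.

(** With [d = 1 - |z|], the terms of [schwarzian_formula] contribute at most [4 * 68],
    [68^2 / 2], [2 * (4 + 68)] and [4] after multiplication by [d^2]. *)
Lemma schwarzian_growth (phi q h g : C -> C) :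
  analytic_in_disk phi -> univalent_in_disk phi ->
  convex_in_horizontal_direction (range_of_disk phi) -> analytic_in_disk q ->
  (forall z : C, disk z -> Cmod (q z) < 1) -> harmonic_shear phi q h g ->
  forall z, disk z -> (1 - Cmod z) ^ 2 * Cmod (schwarzian h g z) <= 2732.
Proof.
intros Hphi Huni Hconv Hq Hqb Hs z Hz.
assert (Hn : forall w, disk w -> C_derive h w <> 0%C).
{ intros w Hw E.
  apply (univalent_derive_neq_0 phi w (1 - Cmod w)).
  - unfold disk in Hw; lra.
  - now apply analytic_sub_ball.
  - intros x y Hx Hy. apply Huni; eapply in_sub_ball; eassumption.
  - rewrite (shear_derivative phi q h g w Hs Hw), E; ring. }
assert (Hh : analytic_in_disk h) by apply Hs.
assert (Hdil : forall w, disk w -> C_derive g w = (q w ^ 2 * C_derive h w)%C) by apply Hs.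
rewrite (schwarzian_formula h g q z Hh Hq Hz Hdil Hn).
set (P := fun w => (C_derive (C_derive h) w / C_derive h w)%C).
change (C_derive (C_derive h) z / C_derive h z)%C with (P z).
change (fun w => C_derive (C_derive h) w / C_derive h w)%C with P.
assert (HP : analytic_in_disk P).
{ intros w Hw. eexists. apply (is_Cderive_div (C_derive (C_derive h)) (C_derive h)).
  - now apply Hn.
  - apply C_derive_is, (analytic_derive _ (analytic_derive _ Hh)), Hw.
  - apply C_derive_is. now apply analytic_derive. }
assert (HPb : forall w, disk w -> (1 - Cmod w) * Cmod (P w) <= 68).
{ intros w Hw. apply (shear_pre_schwarzian_bound phi q h g); auto. }
assert (Hq1b : forall w, disk w -> (1 - Cmod w) * Cmod (C_derive q w) <= 1).
{ intros w Hw. generalize (schwarz_pick q w Hq Hqb Hw) (pow2_ge_0 (Cmod (q w))). lra. }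
assert (B1 := derivative_growth P z 68 HP HPb Hz).
assert (B2 := derivative_growth (C_derive q) z 1 (analytic_derive q Hq) Hq1b Hz).
assert (B3 := HPb z Hz). assert (B4 := Hq1b z Hz).
assert (B5 := Cmod_dilatation_weight q z).
set (s := dilatation_weight q z) in *.
assert (Hd : 0 < 1 - Cmod z) by (unfold disk in Hz; lra).
set (d := 1 - Cmod z) in *.
assert (T : Cmod (C_derive P z - P z * P z / RtoC 2 +
   RtoC 2 * s * (C_derive (C_derive q) z - C_derive q z * P z)
   - RtoC 4 * (C_derive q z * C_derive q z * (s * s))) <=
  Cmod (C_derive P z) + Cmod (P z) * Cmod (P z) / 2 + 2 * Cmod s * (Cmod (C_derive (C_derive q) z)
   + Cmod (C_derive q z) * Cmod (P z)) + 4 * (Cmod (C_derive q z) * Cmod (C_derive q z) * (Cmod s * Cmod s))).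
{ eapply Rle_trans; [apply Cmod_minus_le|]. apply Rplus_le_compat.
  - eapply Rle_trans; [apply Cmod_triangle|]. apply Rplus_le_compat.
    + eapply Rle_trans; [apply Cmod_minus_le|]. apply Rplus_le_compat_l.
      right. rewrite Cmod_div, Cmod_mult, Cmod_R, Rabs_pos_eq; [reflexivity | lra |].
      intros E; apply RtoC_inj in E; lra.
    + rewrite !Cmod_mult, Cmod_R, (Rabs_pos_eq 2) by lra.
      apply Rmult_le_compat_l; [generalize (Cmod_ge_0 s); lra|].
      eapply Rle_trans; [apply Cmod_minus_le|]. rewrite Cmod_mult. lra.
  - rewrite !Cmod_mult, Cmod_R, (Rabs_pos_eq 4) by lra. lra. }
eapply Rle_trans; [apply Rmult_le_compat_l; [apply pow2_ge_0 | exact T]|].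
assert (N1 := Cmod_ge_0 (C_derive P z)). assert (N2 := Cmod_ge_0 (P z)).
assert (N3 := Cmod_ge_0 (C_derive (C_derive q) z)). assert (N4 := Cmod_ge_0 (C_derive q z)).
assert (N5 := Cmod_ge_0 s).
set (p1 := Cmod (C_derive P z)) in *. set (p0 := Cmod (P z)) in *.
set (q2 := Cmod (C_derive (C_derive q) z)) in *. set (q1 := Cmod (C_derive q z)) in *.
set (s0 := Cmod s) in *. clearbody p1 p0 q2 q1 s0 d. clear -B1 B2 B3 B4 B5 Hd N1 N2 N3 N4 N5.
assert (M1 : (d * p0) * (d * p0) <= 68 * 68)
  by (apply Rmult_le_compat; try lra; apply Rmult_le_pos; lra).
assert (M2 : (d * q1) * (d * p0) <= 1 * 68)
  by (apply Rmult_le_compat; try lra; apply Rmult_le_pos; lra).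
assert (M3 : (d * q1) * (d * q1) <= 1 * 1)
  by (apply Rmult_le_compat; try lra; apply Rmult_le_pos; lra).
assert (M4 : s0 * (d ^ 2 * q2 + (d * q1) * (d * p0)) <= 1 * (4 * 1 + 68)).
{ apply Rmult_le_compat; try lra.
  apply Rplus_le_le_0_compat; repeat apply Rmult_le_pos; try lra. }
assert (M5 : s0 * s0 <= 1 * 1) by (apply Rmult_le_compat; lra).
assert (M6 : (d * q1) * (d * q1) * (s0 * s0) <= 1 * 1 * (1 * 1)).
{ apply Rmult_le_compat; try lra; repeat apply Rmult_le_pos; lra. }
replace (d ^ 2 * (p1 + p0 * p0 / 2 + 2 * s0 * (q2 + q1 * p0) + 4 * (q1 * q1 * (s0 * s0)))) with
  (d ^ 2 * p1 + (d * p0) * (d * p0) / 2 + 2 * (s0 * (d ^ 2 * q2 + (d * q1) * (d * p0)))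
   + 4 * ((d * q1) * (d * q1) * (s0 * s0))) by field.
lra.
Qed.

Theorem theorem4 :
  forall phi q h g : C -> C,
    analytic_in_disk phi ->
    univalent_in_disk phi ->
    convex_in_horizontal_direction (range_of_disk phi) ->
    analytic_in_disk q ->
    (forall z : C, disk z -> Cmod (q z) < 1) ->
    harmonic_shear phi q h g ->
    Rbar_lt (schwarzian_norm h g) p_infty.
Proof.
intros phi q h g Hphi Huni Hconv Hq Hqb Hs.
apply Rbar_le_lt_trans with (Finite (4 * 2732)); [|exact I].
unfold schwarzian_norm. apply (proj2 (Lub_Rbar_correct _)).
intros r [z [Hz ->]]. simpl.
assert (H := schwarzian_growth phi q h g Hphi Huni Hconv Hq Hqb Hs z Hz).
assert (H0 := Cmod_ge_0 (schwarzian h g z)). assert (Hc := Cmod_ge_0 z).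
unfold disk in Hz.
assert (Hle : (1 - Cmod z ^ 2) ^ 2 <= 4 * (1 - Cmod z) ^ 2).
{ replace ((1 - Cmod z ^ 2) ^ 2) with ((1 + Cmod z) ^ 2 * (1 - Cmod z) ^ 2) by ring.
  apply Rmult_le_compat_r; [apply pow2_ge_0|]. nra. }
apply Rle_trans with (4 * (1 - Cmod z) ^ 2 * Cmod (schwarzian h g z)); [|simpl in H; lra].
apply Rmult_le_compat_r; [exact H0 | exact Hle].
Qed.
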